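(* Let $a$ be a complex number with $\operatorname{Re} a>0$. Then $$\int_0^\infty \frac{\sin x}{\cosh ax-\cos x}\,\frac{x\,dx}{x^2-\pi^2}=\frac{a}{1+a^2}-\tan^{-1}\!\left(\frac1a\right).$$
   Context: $\tan^{-1}$ denotes the principal branch of the arctangent. The singularities of the integrand at $x=0$ and $x=\pi$ are removable. *)

(* Defs.v *)
From Stdlib Require Import Reals.
From Coquelicot Require Import Coquelicot.

Open Scope R_scope.

Definition Cexp (z : C) : C := (exp (Re z) * cos (Im z), exp (Re z) * sin (Im z)).

Definition Ccosh (z : C) : C := ((Cexp z + Cexp (- z)) / 2)%C.

(* Principal argument, with values in (-PI, PI].  The value at 0 is junk. *)
Definition Carg (z : C) : R :=
  if Rle_dec 0 (Im z) then acos (Re z / Cmod z) else - acos (Re z / Cmod z).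

(* Principal logarithm, cut along the nonpositive real axis. *)
Definition Clog (z : C) : C := (ln (Cmod z), Carg z).

(* Principal arctangent; its cuts are the half-lines of the imaginary axis
   from i upwards and from -i downwards. *)
Definition Catan (z : C) : C :=
  ((Clog (1 + Ci * z) - Clog (1 - Ci * z)) / (2 * Ci))%C.

(* At the removable singularities x = 0 and x = PI total division makes this
   function 0; the integral does not depend on these two values. *)
Definition integrand (a : C) (x : R) : C :=
  (RtoC (sin x) / (Ccosh (a * RtoC x) - RtoC (cos x))
   * (RtoC x / (RtoC x ^ 2 - RtoC PI ^ 2)))%C.

(* Main.v *)
Require Import Defs.
From Stdlib Require Import Reals Lra Lia Psatz.
From Coquelicot Require Import Coquelicot.
Open Scope R_scope.

(* For Re y > 0, sin x / (cosh y - cos x) = 2 sum_{n >= 1} e^{-ny} sin nx, and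
   x sin nx / (x^2 - pi^2) = (-1)^n n int_0^1 cos(n pi s) cos(n x s) ds absorbs the pole.
   Exchanging the two integrals, the n-th term contributes
   2 (-1)^n int_0^1 cos(n pi s) phi(s) ds with phi(s) = a / (a^2 + s^2), the n-th term at s = 1
   of the cosine series of phi on [0, 1].  The sum is therefore
   phi(1) - int_0^1 phi = a / (1 + a^2) - arctan(1/a).
   The exchange of sum and integral is justified by the closed form of the remainder of the
   series after n terms, whose integral over [0, B] is O(1/n) uniformly in B. *)

(** No infinite sum is ever formed. With N + 1 terms and a finite B, the integral over [0, B]
    differs from the partial cosine sum at 1 by at most C1 / (N + 1) + C2 (N + 1) / B: the first
    part is the series remainder, the second the primitives of the terms at B. Fixing N before
    sending B to infinity makes the growing factor N + 1 harmless and takes the place of dominated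
    convergence. The rate 1 / n of the remainder is a matter of scaling: once its zeros at 0 and PI
    have cancelled those of the denominators, it is dominated by a function of n x alone. The cosine
    series is needed at s = 1, where the even 2-periodic extension of phi may have a corner; its
    convergence there is proved directly with the Dirichlet kernel, from phi being continuously
    differentiable. *)

Ltac continuous_by_derive :=
  apply (ex_derive_continuous (K := R_AbsRing) (V := R_NormedModule)); auto_derive.

(** * Integrals insensitive to one point, and removable singularities *)

(** Cutting at [p] makes it an end point of both halves, and [is_RInt_ext] ignores end points.
    Serves at PI, where total division gives the integrand a junk value. *)
Lemma is_RInt_ext_except (f g : R -> R) (a b p l : R) (hab : a <= b)
    (hfg : forall x, a < x < b -> x <> p -> f x = g x) :
  is_RInt f a b l -> is_RInt g a b l.
Proof.
  intros hf.
  destruct (Rlt_dec a p) as [hap|hap].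
  2:{ apply (is_RInt_ext f); [|exact hf].
      rewrite Rmin_left, Rmax_right by lra; intros x hx; apply hfg; lra. }
  destruct (Rlt_dec p b) as [hpb|hpb].
  2:{ apply (is_RInt_ext f); [|exact hf].
      rewrite Rmin_left, Rmax_right by lra; intros x hx; apply hfg; lra. }
  assert (h1 : ex_RInt f a p)
    by (apply (ex_RInt_Chasles_1 f a p b); [lra | exists l; exact hf]).
  assert (h2 : ex_RInt f p b)
    by (apply (ex_RInt_Chasles_2 f a p b); [lra | exists l; exact hf]).
  destruct h1 as [l1 h1], h2 as [l2 h2].
  assert (hl : l = plus l1 l2).
  { transitivity (RInt f a b).
    - symmetry; apply is_RInt_unique; exact hf.
    - apply is_RInt_unique; apply is_RInt_Chasles with p; assumption. }
  rewrite hl; apply is_RInt_Chasles with p.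
  - apply (is_RInt_ext f); [|exact h1].
    rewrite Rmin_left, Rmax_right by lra; intros x hx; apply hfg; lra.
  - apply (is_RInt_ext f); [|exact h2].
    rewrite Rmin_left, Rmax_right by lra; intros x hx; apply hfg; lra.
Qed.

Lemma ex_RInt_ext_except (f g : R -> R) (a b p : R) (hab : a <= b)
    (hfg : forall x, a < x < b -> x <> p -> f x = g x) :
  ex_RInt f a b -> ex_RInt g a b.
Proof.
  intros [l hl]; exists l; exact (is_RInt_ext_except f g a b p l hab hfg hl).
Qed.

Lemma abs_RInt_le_except (f g : R -> R) (a b p : R) (hab : a <= b)
    (hf : ex_RInt f a b) (hg : ex_RInt g a b) (hg0 : forall x, a < x < b -> 0 <= g x)
    (hfg : forall x, a < x < b -> x <> p -> Rabs (f x) <= g x) :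
  Rabs (RInt f a b) <= RInt g a b.
Proof.
  (* Resetting the value at [p] to 0 keeps the integral and makes the pointwise bound hold at [p]
     too. *)
  set (f0 := fun x => if Req_dec_T x p then 0 else f x).
  assert (hf0 : is_RInt f0 a b (RInt f a b)).
  { apply (is_RInt_ext_except f f0 a b p); [exact hab| |exact (RInt_correct (V := R_CompleteNormedModule) f a b hf)].
    intros x _ hx; unfold f0; destruct (Req_dec_T x p); [contradiction|reflexivity]. }
  rewrite <- (is_RInt_unique _ _ _ _ hf0).
  assert (he : ex_RInt f0 a b) by (eexists; exact hf0).
  eapply Rle_trans; [apply abs_RInt_le; assumption|].
  apply RInt_le; [exact hab| |exact hg|].
  - apply (ex_RInt_norm f0); exact he.
  - intros x hx; unfold f0; destruct (Req_dec_T x p).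
    + rewrite Rabs_R0; apply hg0; exact hx.
    + apply hfg; assumption.
Qed.

Definition diffquot (f : R -> R) (p l x : R) : R :=
  if Req_dec_T x p then l else f x / (x - p).

Lemma diffquot_eq (f : R -> R) (p l x : R) (hx : x <> p) :
  diffquot f p l x = f x / (x - p).
Proof. unfold diffquot; destruct (Req_dec_T x p); [contradiction|reflexivity]. Qed.

(** At [p], since [f p = 0], continuity is the convergence of the difference quotient to [l];
    elsewhere this is a quotient of continuous functions. *)
Lemma continuous_diffquot (f : R -> R) (p l : R) (hp : f p = 0)
    (hl : is_derive f p l) (hf : forall x, continuous f x) (x : R) :
  continuous (diffquot f p l) x.
Proof.
  destruct (Req_dec_T x p) as [->|hx].
  - apply is_derive_Reals in hl.
    apply continuity_pt_filterlim.
    intros e he; destruct (hl e he) as [d hd].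
    exists d; split; [apply cond_pos|].
    intros y [[_ hy] hyd]; simpl in *; unfold Rdist in *.
    specialize (hd (y - p) ltac:(lra) hyd).
    replace (p + (y - p)) with y in hd by ring.
    rewrite hp, Rminus_0_r in hd.
    unfold diffquot at 2; destruct (Req_dec_T p p); [|contradiction].
    rewrite diffquot_eq by auto; exact hd.
  - apply (continuous_ext_loc _ (fun y => f y / (y - p))).
    + assert (hr : 0 < Rabs (x - p)) by (apply Rabs_pos_lt; lra).
      exists (mkposreal _ hr); intros y hy.
      symmetry; apply diffquot_eq; intros ->.
      unfold ball in hy; simpl in hy; unfold AbsRing_ball, abs, minus, plus, opp in hy; simpl in hy.
      rewrite Rabs_minus_sym in hy; unfold Rminus in hy; lra.
    + apply (continuous_mult (K := R_AbsRing)); [apply hf|].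
      apply continuous_Rinv_comp; [|lra].
      apply (continuous_minus (V := R_NormedModule)); [apply continuous_id|apply continuous_const].
Qed.

(** * Elementary bounds for cosh, sine and cosine *)

Lemma is_derive_nonneg_incr (f df : R -> R) (hf : forall x, is_derive f x (df x))
    (h : forall x, 0 <= x -> 0 <= df x) (x : R) (hx : 0 <= x) : f 0 <= f x.
Proof.
  destruct (MVT_gen f 0 x df) as [c [hc he]].
  - intros; apply hf.
  - intros y _; apply continuity_pt_filterlim, (ex_derive_continuous (K := R_AbsRing) (V := R_NormedModule)); eexists; apply hf.
  - rewrite Rmin_left, Rmax_right in hc by lra.
    specialize (h c ltac:(lra)); nra.
Qed.

(** Integrate cosh - 1 >= 0 twice. The quadratic bound matches the double zero of cosh ax - cos x at
    0. *)
Lemma cosh_ge_quadratic (x : R) : x ^ 2 / 2 <= cosh x - 1.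
Proof.
  assert (h1 : forall y, 0 <= y -> y <= sinh y).
  { intros y hy.
    pose proof (is_derive_nonneg_incr (fun y => sinh y - y) (fun y => cosh y - 1)) as h.
    cut (sinh 0 - 0 <= sinh y - y); [rewrite sinh_0; lra|].
    apply h; [| |exact hy].
    - intros z; unfold sinh, cosh; auto_derive; [easy|field].
    - intros z _. unfold cosh; rewrite exp_Ropp.
      pose proof (exp_pos z) as he. 
      enough (0 <= (exp z - 1) ^ 2 / (2 * exp z)) as e.
      { replace ((exp z + / exp z) / 2 - 1) with ((exp z - 1) ^ 2 / (2 * exp z)); [exact e|field; lra]. }
      apply Rmult_le_pos; [apply pow2_ge_0|apply Rlt_le, Rinv_0_lt_compat; lra]. }
  assert (h2 : forall y, 0 <= y -> y ^ 2 / 2 <= cosh y - 1).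
  { intros y hy.
    pose proof (is_derive_nonneg_incr (fun y => cosh y - y ^ 2 / 2) (fun y => sinh y - y)) as h.
    cut (cosh 0 - 0 ^ 2 / 2 <= cosh y - y ^ 2 / 2); [rewrite cosh_0; lra|].
    apply h; [| |exact hy].
    - intros z; unfold sinh, cosh; auto_derive; [easy|field].
    - intros z hz; specialize (h1 z hz); lra. }
  destruct (Rle_dec 0 x) as [hx|hx]; [apply h2; exact hx|].
  replace (cosh x) with (cosh (- x)) by (unfold cosh; rewrite Ropp_involutive; lra).
  replace (x ^ 2) with ((- x) ^ 2) by ring; apply h2; lra.
Qed.

(** The Taylor bound x - x^3 / 6 <= sin x with x^2 <= 4. The range is chosen to contain
    [0, PI / 2]. *)
Lemma sin_ge_third (x : R) (h0 : 0 <= x) (h2 : x <= 2) : x / 3 <= sin x.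
Proof.
  destruct (pre_sin_bound x 0 h0 ltac:(lra)) as [h _].
  unfold sin_approx, sin_term in h; simpl in h.
  nra.
Qed.

Lemma abs_sin_le (x : R) : Rabs (sin x) <= Rabs x.
Proof.
  assert (h : forall y, 0 <= y -> - y <= sin y <= y).
  { intros y hy; split.
    - cut (sin 0 + 0 <= sin y + y); [rewrite sin_0; lra|].
      apply (is_derive_nonneg_incr (fun y => sin y + y) (fun y => cos y + 1)); [| |exact hy].
      + intros z; auto_derive; [easy|ring].
      + intros z _; pose proof (COS_bound z); lra.
    - cut (0 - sin 0 <= y - sin y); [rewrite sin_0; lra|].
      apply (is_derive_nonneg_incr (fun y => y - sin y) (fun y => 1 - cos y)); [| |exact hy].
      + intros z; auto_derive; [easy|ring].
      + intros z _; pose proof (COS_bound z); lra. }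
  destruct (Rle_dec 0 x) as [hx|hx].
  - rewrite (Rabs_pos_eq x) by lra; apply Rabs_le, h, hx.
  - rewrite (Rabs_left x) by lra. rewrite <- (Ropp_involutive (sin x)), <- sin_neg, Rabs_Ropp.
    apply Rabs_le, h; lra.
Qed.

Lemma one_sub_cos_le (x : R) (hx : 0 <= x) : 1 - cos x <= x.
Proof.
  cut (0 + cos 0 <= x + cos x); [rewrite cos_0; lra|].
  apply (is_derive_nonneg_incr (fun y => y + cos y) (fun y => 1 - sin y)); [| |exact hx].
  - intros z; auto_derive; [easy|ring].
  - intros z _; pose proof (SIN_bound z); lra.
Qed.

Lemma cos_INR_PI (n : nat) : cos (INR n * PI) = (-1) ^ n.
Proof.
  induction n as [|n IH]; [simpl; rewrite Rmult_0_l; apply cos_0|].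
  rewrite S_INR, Rmult_plus_distr_r, Rmult_1_l, neg_cos, IH; simpl; ring.
Qed.

Lemma sin_INR_PI (n : nat) : sin (INR n * PI) = 0.
Proof.
  induction n as [|n IH]; [simpl; rewrite Rmult_0_l; apply sin_0|].
  rewrite S_INR, Rmult_plus_distr_r, Rmult_1_l, neg_sin, IH; ring.
Qed.

Lemma abs_pow_neg_1 (n : nat) : Rabs ((-1) ^ n) = 1.
Proof. exact (pow_1_abs n). Qed.

Lemma abs_sin_INR_le (n : nat) (x : R) : Rabs (sin (INR n * x)) <= INR n * Rabs x.
Proof.
  eapply Rle_trans; [apply abs_sin_le|].
  rewrite Rabs_mult, (Rabs_pos_eq (INR n)) by apply pos_INR; lra.
Qed.

(* The zeros of sin (n x) at 0 and PI absorb both factors of x^2 - PI^2. *)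
Lemma abs_sin_INR_le_pole (n : nat) (x : R) (hx : 0 <= x) :
  Rabs (sin (INR n * x)) <= INR n * x * Rabs (x ^ 2 - PI ^ 2).
Proof.
  pose proof PI_RGT_0 as hp; pose proof PI2_1 as hp2. pose proof (pos_INR n) as hn.
  (* Up to 1 the factor |x^2 - PI^2| is at least 1, as PI > 2. Beyond 1, a shift by n PI turns the
     sine into that of n (x - PI) up to sign, and x (x + PI) >= 1. *)
  destruct (Rle_dec x 1) as [h|h].
  - eapply Rle_trans; [apply abs_sin_INR_le|].
    rewrite (Rabs_pos_eq x hx).
    assert (1 <= Rabs (x ^ 2 - PI ^ 2)).
    { rewrite Rabs_left by nra; nra. }
    assert (0 <= INR n * x) by nra. nra.
  - replace (INR n * x) with (INR n * (x - PI) + INR n * PI) at 1 by ring.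
    rewrite sin_plus, sin_INR_PI, Rmult_0_r, Rplus_0_r, Rabs_mult, cos_INR_PI, abs_pow_neg_1, Rmult_1_r.
    eapply Rle_trans; [apply abs_sin_INR_le|].
    replace (x ^ 2 - PI ^ 2) with ((x - PI) * (x + PI)) by ring.
    rewrite Rabs_mult, (Rabs_pos_eq (x + PI)) by lra.
    pose proof (Rabs_pos (x - PI)).
    assert (1 <= x * (x + PI)) by nra.
    assert (0 <= INR n * Rabs (x - PI)) by nra. nra.
Qed.

Lemma continuous_of_is_derive (f : R -> R) (x l : R) (h : is_derive f x l) : continuous f x.
Proof.
  apply (ex_derive_continuous (K := R_AbsRing) (V := R_NormedModule)).
  exists l; exact h.
Qed.

Lemma ex_RInt_of_continuous (f : R -> R) (a b : R) (h : forall x, continuous f x) : ex_RInt f a b.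
Proof. apply (ex_RInt_continuous (V := R_CompleteNormedModule)); intros; apply h. Qed.

Lemma is_RInt_of_is_derive (f df : R -> R) (a b : R) (hab : a <= b)
    (hf : forall x, a <= x <= b -> is_derive f x (df x))
    (hc : forall x, a <= x <= b -> continuous df x) : is_RInt df a b (f b - f a).
Proof.
  apply (is_RInt_derive (V := R_CompleteNormedModule) f df);
    rewrite Rmin_left, Rmax_right by lra; assumption.
Qed.

(** * The Dirichlet kernel and the cosine series at the end point 1 *)

(* Dirichlet kernel at 1 - s, minus its constant term 1. *)
Definition cosker (N : nat) (s : R) : R :=
  sum_f_R0 (fun k => 2 * (-1) ^ S k * cos (INR (S k) * PI * s)) N.

(** Product-to-sum telescopes after multiplication by cos (PI s / 2), which is sin (theta / 2) for
    theta = PI (1 - s). [cosker N] has N + 1 terms, whence the frequency 2N + 3. *)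
Lemma cosker_closed (N : nat) (s : R) :
  (1 + cosker N s) * cos (PI * s / 2) = (-1) ^ S N * cos ((2 * INR N + 3) * (PI * s / 2)).
Proof.
  assert (h : forall u v, 2 * cos u * cos v = cos (u + v) + cos (u - v))
    by (intros; rewrite cos_plus, cos_minus; ring).
  unfold cosker; induction N as [|N IH].
  - simpl. 
    pose proof (h (1 * PI * s) (PI * s / 2)) as e.
    replace (1 * PI * s + PI * s / 2) with ((2 * 0 + 3) * (PI * s / 2)) in e by field.
    replace (1 * PI * s - PI * s / 2) with (PI * s / 2) in e by field.
    nra.
  - rewrite tech5.
    pose proof (h (INR (S (S N)) * PI * s) (PI * s / 2)) as e.
    replace (INR (S (S N)) * PI * s + PI * s / 2)
      with ((2 * INR (S N) + 3) * (PI * s / 2)) in e by (rewrite !S_INR; field).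
    replace (INR (S (S N)) * PI * s - PI * s / 2)
      with ((2 * INR N + 3) * (PI * s / 2)) in e by (rewrite !S_INR; field).
    rewrite <- Rplus_assoc, Rmult_plus_distr_r, IH.
    replace (2 * (-1) ^ S (S N) * cos (INR (S (S N)) * PI * s) * cos (PI * s / 2))
      with ((-1) ^ S (S N) * (2 * cos (INR (S (S N)) * PI * s) * cos (PI * s / 2))) by ring.
    rewrite e; simpl; ring.
Qed.

Lemma continuous_cosker (N : nat) (s : R) : continuous (cosker N) s.
Proof.
  unfold cosker; induction N as [|N IH].
  - apply (continuous_ext (fun s => 2 * (-1) ^ 1 * cos (INR 1 * PI * s))); [reflexivity|].
    continuous_by_derive; easy.
  - apply (continuous_plus (V := R_NormedModule) _ _ _ IH).
    continuous_by_derive; easy.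
Qed.

Lemma is_RInt_cosker (N : nat) : is_RInt (cosker N) 0 1 0.
Proof.
  assert (h : forall k, is_RInt (fun s => 2 * (-1) ^ S k * cos (INR (S k) * PI * s)) 0 1 0).
  { intros k.
    assert (hk : INR (S k) * PI <> 0)
      by (apply Rmult_integral_contrapositive; split; [apply not_0_INR; lia|apply PI_neq0]).
    replace 0 with (2 * (-1) ^ S k * sin (INR (S k) * PI * 1) / (INR (S k) * PI)
      - 2 * (-1) ^ S k * sin (INR (S k) * PI * 0) / (INR (S k) * PI)) at 2.
    2:{ rewrite Rmult_1_r, sin_INR_PI, (Rmult_0_r (INR (S k) * PI)), sin_0; field; split; [apply PI_neq0|apply not_0_INR; lia]. }
    apply (is_RInt_of_is_derive (fun s => 2 * (-1) ^ S k * sin (INR (S k) * PI * s) / (INR (S k) * PI))); [lra| |].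
    - intros x _. generalize dependent (INR (S k)); intros q hq.
      generalize ((-1) ^ S k); intros r.
      auto_derive; [easy|]. field; split; [apply PI_neq0|]. intros e; apply hq; rewrite e; ring.
    - intros x _; continuous_by_derive; easy. }
  unfold cosker; induction N as [|N IH]; [apply h|].
  replace 0 with (0 + 0) at 2 by ring.
  apply (is_RInt_plus (V := R_NormedModule) _ _ _ _ _ _ IH (h (S N))).
Qed.

(** Shifting gives sin (PI (1 - s) / 2) >= PI (1 - s) / 6, and PI > 3. The simple zero at s = 1 will
    be absorbed by [f s - f 1]. *)
Lemma cos_half_PI_ge (s : R) (h0 : 0 <= s) (h1 : s <= 1) : (1 - s) / 2 <= cos (PI * s / 2).
Proof.
  pose proof PI2_3_2; pose proof PI_4.
  replace (PI * s / 2) with (PI / 2 - PI * (1 - s) / 2) by field.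
  rewrite cos_shift.
  assert (h : PI * (1 - s) / 2 / 3 <= sin (PI * (1 - s) / 2)) by (apply sin_ge_third; nra).
  nra.
Qed.

Section Fourier.
Variables (f df : R -> R) (M : R).
Hypothesis hf : forall x, is_derive f x (df x).
Hypothesis hdf : forall x, continuous df x.
Hypothesis hM : forall x, 0 <= x <= 1 -> Rabs (df x) <= M.

Lemma abs_sub_right_end_le (s : R) (hs : 0 <= s <= 1) : Rabs (f s - f 1) <= M * (1 - s).
Proof.
  destruct (MVT_gen f s 1 df) as [c [hc he]].
  - intros; apply hf.
  - intros y _; apply continuity_pt_filterlim; eapply continuous_of_is_derive, hf.
  - rewrite Rmin_left, Rmax_right in hc by lra.
    rewrite Rabs_minus_sym, he, Rabs_mult, (Rabs_pos_eq (1 - s)) by lra.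
    apply Rmult_le_compat_r; [lra|apply hM; lra].
Qed.

(** As [1 + cosker N] has integral 1, the integral of [w N] is exactly the error: partial sum minus
    f(1) - int_0^1 f. *)
Let w (N : nat) (s : R) := (1 + cosker N s) * (f s - f 1).

Lemma continuous_dirichlet_defect (N : nat) (s : R) : continuous (w N) s.
Proof.
  apply (continuous_mult (K := R_AbsRing)).
  - apply (continuous_plus (V := R_NormedModule)); [apply continuous_const|apply continuous_cosker].
  - apply (continuous_minus (V := R_NormedModule)); [|apply continuous_const].
    eapply continuous_of_is_derive, hf.
Qed.

(** Near 1 the kernel is at most 2 / (1 - s) and the increment of [f] at most M (1 - s), so the
    product is bounded by 2 M uniformly in N. *)
Lemma dirichlet_tail_le (N : nat) (d : R) (hd : 0 < d < 1) :
  Rabs (RInt (w N) (1 - d) 1) <= 2 * M * d.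
Proof.
  replace (2 * M * d) with ((1 - (1 - d)) * (2 * M)) by ring.
  assert (hM0 : 0 <= M) by (eapply Rle_trans; [apply Rabs_pos|apply (hM 0); lra]).
  pose proof (abs_RInt_le_except (w N) (fun _ => 2 * M) (1 - d) 1 1 ltac:(lra)) as h.
  rewrite (is_RInt_unique (fun _ => 2 * M) _ _ _ (is_RInt_const (V := R_NormedModule) (1 - d) 1 (2 * M))) in h.
  apply h.
  - apply ex_RInt_of_continuous, continuous_dirichlet_defect.
  - apply ex_RInt_const.
  - intros; lra.
  - intros s hs _; unfold w.
    pose proof (cos_half_PI_ge s ltac:(lra) ltac:(lra)) as hc.
    pose proof (abs_sub_right_end_le s ltac:(lra)) as hv.
    assert (hk : Rabs (1 + cosker N s) * cos (PI * s / 2) <= 1).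
    { rewrite <- (Rabs_pos_eq (cos (PI * s / 2))) by lra.
      rewrite <- Rabs_mult, cosker_closed, Rabs_mult, abs_pow_neg_1, Rmult_1_l.
      apply Rabs_le, COS_bound. }
    rewrite Rabs_mult.
    pose proof (Rabs_pos (1 + cosker N s)); pose proof (Rabs_pos (f s - f 1)).
    apply Rle_trans with (Rabs (1 + cosker N s) * (M * (1 - s))); [apply Rmult_le_compat_l; assumption|].
    apply Rle_trans with (Rabs (1 + cosker N s) * (2 * M * cos (PI * s / 2))).
    + apply Rmult_le_compat_l; nra.
    + nra.
Qed.

(** With L = (2N + 3) PI / 2, [w N s] is a sign times [u s] cos (L s). Away from 1, [u] is
    continuously differentiable with derivative [du]. *)
Let u (s : R) := (f s - f 1) / cos (PI * s / 2).
Let du (s : R) := df s / cos (PI * s / 2)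
  + (f s - f 1) * (PI / 2) * sin (PI * s / 2) / cos (PI * s / 2) ^ 2.

(** Riemann-Lebesgue with a rate: integrating by parts against cos (L s) gains 1 / L. From |u| <= 2
    M and |du| <= 10 M / d, the boundary term and the remaining integral add up to at most 12 M / d
    / L, and L >= N + 1. *)
Lemma dirichlet_main_le (N : nat) (d : R) (hd : 0 < d < 1) :
  Rabs (RInt (w N) 0 (1 - d)) <= 12 * M / d / (INR N + 1).
Proof.
  assert (hM0 : 0 <= M) by (eapply Rle_trans; [apply Rabs_pos|apply (hM 0); lra]).
  pose proof PI2_1 as hpi; pose proof PI_4 as hpi4; pose proof (pos_INR N) as hN.
  set (L := (2 * INR N + 3) * (PI / 2)).
  assert (hL : INR N + 1 <= L) by (unfold L; nra).
  assert (hcos : forall s, 0 <= s <= 1 - d -> d / 2 <= cos (PI * s / 2)).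
  { intros s hs; pose proof (cos_half_PI_ge s ltac:(lra) ltac:(lra)); lra. }
  assert (hu : forall s, 0 <= s <= 1 - d -> is_derive u s (du s)).
  { intros s hs; specialize (hcos s hs); unfold u, du.
    evar_last.
    - apply is_derive_div.
      + apply (is_derive_minus (V := R_NormedModule)); [apply hf|apply is_derive_const].
      + instantiate (1 := - (PI / 2) * sin (PI * s / 2)). auto_derive; [easy|]. unfold Rdiv; ring.
      + lra.
    - unfold minus, plus, opp, zero; simpl; field; lra. }
  assert (hduc : forall s, 0 <= s <= 1 - d -> continuous du s).
  { intros s hs; specialize (hcos s hs); unfold du.
    apply (continuous_plus (V := R_NormedModule)).
    - apply (continuous_mult (K := R_AbsRing)); [apply hdf|].
      continuous_by_derive; unfold Rdiv in hcos; lra.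
    - apply (continuous_mult (K := R_AbsRing)).
      + apply (continuous_mult (K := R_AbsRing)).
        * apply (continuous_mult (K := R_AbsRing)); [|apply continuous_const].
          apply (continuous_minus (V := R_NormedModule)); [eapply continuous_of_is_derive, hf|apply continuous_const].
        * continuous_by_derive; easy.
      + continuous_by_derive.
        change (PI * s * / 2) with (PI * s / 2); nra. }
  assert (huc : forall s, 0 <= s <= 1 - d -> Rabs (u s) <= 2 * M).
  { intros s hs; specialize (hcos s hs). pose proof (cos_half_PI_ge s ltac:(lra) ltac:(lra)) as hc.
    pose proof (abs_sub_right_end_le s ltac:(lra)) as hv.
    unfold u; rewrite Rabs_div, (Rabs_pos_eq (cos _)) by lra.
    apply Rle_div_l; [lra|]. nra. }
  assert (hdub : forall s, 0 <= s <= 1 - d -> Rabs (du s) <= 10 * M / d).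
  { intros s hs. pose proof (hcos s hs) as hc1. specialize (huc s hs).
    replace (du s) with ((df s + (PI / 2) * u s * sin (PI * s / 2)) / cos (PI * s / 2))
      by (unfold du, u; field; lra).
    rewrite Rabs_div, (Rabs_pos_eq (cos _)) by lra.
    apply Rle_div_l; [lra|].
    (* M comes from [df], and 4 M from PI / 2 <= 2 and |u| <= 2 M; dividing by cos >= d / 2 then
       gives 10 M / d. *)
    assert (h5 : Rabs (df s + PI / 2 * u s * sin (PI * s / 2)) <= 5 * M).
    { eapply Rle_trans; [apply Rabs_triang|].
      rewrite !Rabs_mult, (Rabs_pos_eq (PI / 2)) by lra.
      assert (Rabs (sin (PI * s / 2)) <= 1) by apply Rabs_le, SIN_bound.
      pose proof (hM s ltac:(lra)). pose proof (Rabs_pos (u s)). pose proof (Rabs_pos (sin (PI * s / 2))).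
      assert (PI / 2 * Rabs (u s) <= 4 * M) by nra.
      assert (0 <= PI / 2 * Rabs (u s)) by nra.
      nra. }
    eapply Rle_trans; [exact h5|].
    replace (5 * M) with (10 * M / d * (d / 2)) by (field; lra).
    apply Rmult_le_compat_l; [|exact hc1].
    apply Rmult_le_pos; [lra|apply Rlt_le, Rinv_0_lt_compat; lra]. }
  (* [F] is the boundary term of the integration by parts and [G] what it leaves: F' = w N + G. *)
  set (F := fun s => (-1) ^ S N * (u s * sin (L * s)) / L).
  set (G := fun s => (-1) ^ S N * (du s * sin (L * s)) / L).
  assert (hGc : forall s, 0 <= s <= 1 - d -> continuous G s).
  { intros s hs; unfold G. apply (continuous_mult (K := R_AbsRing)); [|apply continuous_const].
    apply (continuous_mult (K := R_AbsRing)); [apply continuous_const|].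
    apply (continuous_mult (K := R_AbsRing)); [apply hduc; exact hs|].
    continuous_by_derive; easy. }
  assert (hG : ex_RInt G 0 (1 - d)).
  { apply (ex_RInt_continuous (V := R_CompleteNormedModule)).
    rewrite Rmin_left, Rmax_right by lra; exact hGc. }
  assert (hint : is_RInt (fun s => w N s + G s) 0 (1 - d) (F (1 - d) - F 0)).
  { apply is_RInt_of_is_derive; [lra| |].
    - intros s hs; specialize (hcos s hs). unfold F.
      evar_last.
      + apply (is_derive_ext (fun s => ((-1) ^ S N / L) * (u s * sin (L * s)))).
        { intros t; change ((-1) ^ S N / L * (u t * sin (L * t)) = (-1) ^ S N * (u t * sin (L * t)) / L).
          field; lra. }
        apply is_derive_scal.
        apply Derive.is_derive_mult; [apply hu; exact hs|].
        instantiate (1 := L * cos (L * s)). auto_derive; [easy|ring].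
      + unfold G, w. 
        assert (hk : 1 + cosker N s = (-1) ^ S N * cos (L * s) / cos (PI * s / 2)).
        { replace (L * s) with ((2 * INR N + 3) * (PI * s / 2)) by (unfold L; field).
          rewrite <- cosker_closed; field; lra. }
        rewrite hk. unfold mult, plus; simpl. unfold mult; simpl. unfold u. field. split; lra.
    - intros s hs. apply (continuous_plus (V := R_NormedModule)); [apply continuous_dirichlet_defect|apply hGc; exact hs]. }
  assert (hw : RInt (w N) 0 (1 - d) = F (1 - d) - F 0 - RInt G 0 (1 - d)).
  { apply is_RInt_unique.
    apply (is_RInt_ext (fun s => minus (w N s + G s) (G s))).
    { intros; unfold minus, plus, opp; simpl; ring. }
    apply (is_RInt_minus (V := R_NormedModule)); [exact hint|].
    exact (RInt_correct (V := R_CompleteNormedModule) G _ _ hG). }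
  rewrite hw.
  assert (hF0 : F 0 = 0) by (unfold F; rewrite Rmult_0_r, sin_0; field; lra).
  assert (hsin : forall x, Rabs (sin x) <= 1) by (intros; apply Rabs_le, SIN_bound).
  assert (hF1 : Rabs (F (1 - d)) <= 2 * M / L).
  { unfold F. rewrite Rabs_div, (Rabs_pos_eq L) by lra.
    apply Rmult_le_compat_r; [apply Rlt_le, Rinv_0_lt_compat; lra|].
    rewrite !Rabs_mult, abs_pow_neg_1, Rmult_1_l.
    specialize (huc (1 - d) ltac:(lra)). specialize (hsin (L * (1 - d))).
    pose proof (Rabs_pos (u (1 - d))); pose proof (Rabs_pos (sin (L * (1 - d)))). nra. }
  assert (hG1 : Rabs (RInt G 0 (1 - d)) <= 10 * M / d / L).
  { apply Rle_trans with ((1 - d - 0) * (10 * M / d / L)).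
    - apply abs_RInt_le_const; [lra|exact hG|].
      intros s hs; unfold G. rewrite Rabs_div, (Rabs_pos_eq L) by lra.
      apply Rmult_le_compat_r; [apply Rlt_le, Rinv_0_lt_compat; lra|].
      rewrite !Rabs_mult, abs_pow_neg_1, Rmult_1_l.
      specialize (hdub s hs); specialize (hsin (L * s)).
      pose proof (Rabs_pos (du s)); pose proof (Rabs_pos (sin (L * s))). nra.
    - assert (0 <= 10 * M / d / L).
      { apply Rmult_le_pos; [apply Rmult_le_pos; [lra|]|]; apply Rlt_le, Rinv_0_lt_compat; lra. }
      nra. }
  rewrite hF0, Rminus_0_r.
  eapply Rle_trans; [apply Rabs_triang|]. rewrite Rabs_Ropp.
  apply Rle_trans with (12 * M / d / L).
  - apply Rle_trans with (2 * M / d / L + 10 * M / d / L); [|right; field; lra].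
    apply Rplus_le_compat; [|exact hG1]. eapply Rle_trans; [exact hF1|].
    apply Rmult_le_compat_r; [apply Rlt_le, Rinv_0_lt_compat; lra|].
    apply (Rle_div_r (2 * M) (2 * M) d ltac:(lra)). assert (0 <= M * (1 - d)) by (apply Rmult_le_pos; lra); lra.
  - apply Rmult_le_compat_l; [apply Rmult_le_pos; [lra|apply Rlt_le, Rinv_0_lt_compat; lra]|].
    apply Rinv_le_contravar; lra.
Qed.

Lemma is_lim_seq_cosine_sum_bounded :
  is_lim_seq (fun N => RInt (fun s => cosker N s * f s) 0 1) (f 1 - RInt f 0 1).
Proof.
  assert (hM0 : 0 <= M) by (eapply Rle_trans; [apply Rabs_pos|apply (hM 0); lra]).
  assert (hfi : ex_RInt f 0 1) by (apply ex_RInt_of_continuous; intros; eapply continuous_of_is_derive, hf).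
  assert (hwi : forall N a b, ex_RInt (w N) a b) by (intros; apply ex_RInt_of_continuous, continuous_dirichlet_defect).
  assert (he : forall N, RInt (fun s => cosker N s * f s) 0 1 = RInt (w N) 0 1 + (f 1 - RInt f 0 1)).
  { intros N; apply is_RInt_unique.
    replace (RInt (w N) 0 1 + (f 1 - RInt f 0 1))
      with (RInt (w N) 0 1 + (f 1 * 0 + ((1 - 0) * f 1 - RInt f 0 1))) by ring.
    apply (is_RInt_ext (fun s => w N s + (f 1 * cosker N s + (f 1 - f s)))).
    { intros s _; change (w N s + (f 1 * cosker N s + (f 1 - f s)) = cosker N s * f s); unfold w; ring. }
    apply (is_RInt_plus (V := R_NormedModule)); [exact (RInt_correct (V := R_CompleteNormedModule) _ _ _ (hwi N 0 1))|].
    apply (is_RInt_plus (V := R_NormedModule)); [apply (is_RInt_scal (V := R_NormedModule)), is_RInt_cosker|].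
    apply (is_RInt_minus (V := R_NormedModule)); [exact (is_RInt_const (V := R_NormedModule) 0 1 (f 1))|].
    exact (RInt_correct (V := R_CompleteNormedModule) f _ _ hfi). }
  apply is_lim_seq_spec; intros e; pose proof (cond_pos e) as hepos.
  (* The cap 1 / 2 keeps d < 1, and M + 1 allows for M = 0. This [d] makes the part near 1 at most e
     / 2 for every N; only then is N taken large against 12 M / d. *)
  set (d := Rmin (1 / 2) (e / (4 * (M + 1)))).
  assert (hd : 0 < d < 1).
  { split; [apply Rmin_glb_lt; [lra|apply Rdiv_lt_0_compat; lra]|].
    eapply Rle_lt_trans; [apply Rmin_l|lra]. }
  assert (hde : 2 * M * d <= e / 2).
  { apply Rle_trans with (2 * M * (e / (4 * (M + 1)))).
    - apply Rmult_le_compat_l; [lra|apply Rmin_r].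
    - replace (2 * M * (e / (4 * (M + 1)))) with (e / 2 * (M / (M + 1))) by (field; lra).
      assert (M / (M + 1) <= 1) by (apply Rle_div_l; lra). nra. }
  destruct (INR_archimed (e / 2) (12 * M / d)) as [n hn]; [lra|].
  exists n; intros N hN. rewrite he.
  replace (RInt (w N) 0 1 + (f 1 - RInt f 0 1) - (f 1 - RInt f 0 1)) with (RInt (w N) 0 1 : R) by (generalize (RInt (w N) 0 1) (RInt f 0 1); simpl; intros; ring).
  rewrite <- (RInt_Chasles (V := R_CompleteNormedModule) (w N) 0 (1 - d) 1) by apply hwi.
  eapply Rle_lt_trans; [apply Rabs_triang|].
  pose proof (dirichlet_main_le N d hd) as h1. pose proof (dirichlet_tail_le N d hd) as h2.
  apply le_INR in hN. pose proof (pos_INR n).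
  assert (12 * M / d / (INR N + 1) < e / 2).
  { apply Rlt_div_l; [lra|]. nra. }
  lra.
Qed.
End Fourier.

Lemma is_lim_seq_cosine_sum (f df : R -> R) (hf : forall x, is_derive f x (df x))
    (hdf : forall x, continuous df x) :
  is_lim_seq (fun N => RInt (fun s => cosker N s * f s) 0 1) (f 1 - RInt f 0 1).
Proof.
  destruct (continuity_ab_maj (fun x => Rabs (df x)) 0 1 ltac:(lra)) as [m [hm _]].
  { intros c _; apply continuity_pt_filterlim.
    apply (continuous_comp df Rabs); [apply hdf|apply continuous_Rabs]. }
  exact (is_lim_seq_cosine_sum_bounded f df _ hf hdf hm).
Qed.

(** * The integral of a single term of the series *)

(* Complex quantities enter through the real-linear form z |-> Re (c z), with a = al + i be and
   c = c1 + i c2; c = 1 and c = - i give the real and the imaginary part. *)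
Section Term.
Variables (al be c1 c2 : R).
Hypothesis hal : 0 < al.

(* Re (c e^{-nax}). *)
Definition expform (n : nat) (x : R) : R :=
  exp (- (INR n * al * x)) * (c1 * cos (INR n * be * x) + c2 * sin (INR n * be * x)).

(* Re (c e^{-n (al + i t) x} / (al + i t)). *)
Definition resform (n : nat) (x t : R) : R :=
  exp (- (INR n * al * x)) *
  ((c1 * cos (INR n * t * x) + c2 * sin (INR n * t * x)) * al
   + (c2 * cos (INR n * t * x) - c1 * sin (INR n * t * x)) * t) / (al ^ 2 + t ^ 2).

(* Re (c a / (a^2 + s^2)), by partial fractions in s. *)
Definition phiform (s : R) : R :=
  ((c1 * al + c2 * (be + s)) / (al ^ 2 + (be + s) ^ 2)
   + (c1 * al + c2 * (be - s)) / (al ^ 2 + (be - s) ^ 2)) / 2.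

(** For x >= 0 other than PI this is x sin nx / (x^2 - PI^2); the integral form is continuous across
    PI, so the terms need no case distinction there. *)
Definition coskernel (n : nat) (x : R) : R :=
  RInt (fun s => (-1) ^ n * (INR n * cos (INR n * PI * s) * cos (INR n * x * s))) 0 1.

(** A primitive in x, at fixed s, of one term: cos (n x s) e^{-nax} is the average of e^{-n (a + is)
    x} and e^{-n (a - is) x}, each integrated by [resform]. Integrating divides by n, which cancels
    the factor [INR n] of [coskernel]. *)
Definition primform (n : nat) (x s : R) : R :=
  - (2 * (-1) ^ n * cos (INR n * PI * s)) * ((resform n x (be + s) + resform n x (be - s)) / 2).

Definition termprim (n : nat) (x : R) : R := RInt (primform n x) 0 1.

Lemma sumsq_pos (t : R) : 0 < al ^ 2 + t ^ 2.
Proof. nra. Qed.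

Lemma is_derive_resform (n : nat) (t x : R) :
  is_derive (fun x => resform n x t) x
    (- INR n * exp (- (INR n * al * x)) * (c1 * cos (INR n * t * x) + c2 * sin (INR n * t * x))).
Proof.
  pose proof (sumsq_pos t) as h.
  unfold resform; generalize (INR n); intros q.
  auto_derive; [nra|].
  field; nra.
Qed.

Lemma is_derive_primform (n : nat) (s x : R) :
  is_derive (fun x => primform n x s) x
    (2 * expform n x * ((-1) ^ n * (INR n * cos (INR n * PI * s) * cos (INR n * x * s)))).
Proof.
  unfold primform, expform.
  evar_last.
  - apply is_derive_scal.
    apply (is_derive_ext (fun x => / 2 * (resform n x (be + s) + resform n x (be - s)))).
    { intros; unfold Rdiv; apply Rmult_comm. }
    apply is_derive_scal.
    apply (is_derive_plus (V := R_NormedModule)); apply is_derive_resform.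
  - unfold plus; simpl.
    replace (INR n * (be + s) * x) with (INR n * be * x + INR n * x * s) by ring.
    replace (INR n * (be - s) * x) with (INR n * be * x - INR n * x * s) by ring.
    rewrite cos_plus, cos_minus, sin_plus, sin_minus; field.
Qed.

Lemma continuous_expform (n : nat) (x : R) : continuous (fun x => 2 * expform n x) x.
Proof.
  unfold expform; generalize (INR n); intros q.
  continuous_by_derive; easy.
Qed.

Lemma continuous_primform (n : nat) (x s : R) : continuous (primform n x) s.
Proof.
  unfold primform, resform; generalize (INR n); intros q.
  pose proof (sumsq_pos (be + s)); pose proof (sumsq_pos (be - s)).
  continuous_by_derive.
  repeat split; nra.
Qed.

Lemma continuity_2d_cos_lin (q x s : R) : continuity_2d_pt (fun x s => cos (q * x * s)) x s.
Proof.
  apply continuity_1d_2d_pt_comp; [apply continuity_cos|].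
  apply continuity_2d_pt_mult; [|apply continuity_2d_pt_id2].
  apply continuity_2d_pt_mult; [apply continuity_2d_pt_const|apply continuity_2d_pt_id1].
Qed.

Lemma continuity_2d_kernel (n : nat) (x s : R) :
  continuity_2d_pt (fun x s => (-1) ^ n * (INR n * cos (INR n * PI * s) * cos (INR n * x * s))) x s.
Proof.
  apply continuity_2d_pt_mult; [apply continuity_2d_pt_const|].
  apply continuity_2d_pt_mult; [|apply continuity_2d_cos_lin].
  apply continuity_2d_pt_mult; [apply continuity_2d_pt_const|].
  apply continuity_1d_2d_pt_comp; [apply continuity_cos|].
  apply continuity_2d_pt_mult; [apply continuity_2d_pt_const|apply continuity_2d_pt_id2].
Qed.

Lemma ex_RInt_kernel (n : nat) (x : R) :
  ex_RInt (fun s => (-1) ^ n * (INR n * cos (INR n * PI * s) * cos (INR n * x * s))) 0 1.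
Proof.
  apply ex_RInt_of_continuous; intros s.
  continuous_by_derive; easy.
Qed.

(** Differentiation under the integral sign stands in for the exchange of the two integrals: the
    integral of a term over [0, B] becomes a difference of two integrals over s. *)
Lemma is_derive_termprim (n : nat) (x : R) :
  is_derive (termprim n) x (2 * expform n x * coskernel n x).
Proof.
  unfold termprim.
  replace (2 * expform n x * coskernel n x)
    with (RInt (fun s => Derive (fun u => primform n u s) x) 0 1).
  - apply (is_derive_RInt_param (primform n)).
    + apply filter_forall; intros y s _; eexists; apply is_derive_primform.
    + intros s _.
      apply (continuity_2d_pt_ext (fun x s => 2 * expform n x *
        ((-1) ^ n * (INR n * cos (INR n * PI * s) * cos (INR n * x * s))))).
      { intros y t; symmetry; apply is_derive_unique, is_derive_primform. }
      apply continuity_2d_pt_mult; [|apply continuity_2d_kernel].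
      apply (continuity_1d_2d_pt_comp (fun x => 2 * expform n x) (fun x s => x)); [|apply continuity_2d_pt_id1].
      apply continuity_pt_filterlim, continuous_expform.
    + apply filter_forall; intros y; apply ex_RInt_of_continuous, continuous_primform.
  - apply is_RInt_unique.
    apply (is_RInt_ext (fun s => 2 * expform n x *
        ((-1) ^ n * (INR n * cos (INR n * PI * s) * cos (INR n * x * s))))).
    { intros t _; symmetry; apply is_derive_unique, is_derive_primform. }
    apply (is_RInt_scal (V := R_NormedModule)).
    exact (RInt_correct (V := R_CompleteNormedModule) _ _ _ (ex_RInt_kernel n x)).
Qed.

Lemma continuous_coskernel (n : nat) (x : R) : continuous (coskernel n) x.
Proof.
  apply (continuous_of_is_derive _ _ (RInt (fun s => Derive (fun u =>
    (-1) ^ n * (INR n * cos (INR n * PI * s) * cos (INR n * u * s))) x) 0 1)).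
  assert (hd : forall y s, is_derive (fun u => (-1) ^ n * (INR n * cos (INR n * PI * s) * cos (INR n * u * s))) y
      ((-1) ^ n * (INR n * cos (INR n * PI * s) * - (sin (INR n * y * s) * (INR n * s))))).
  { intros y s; generalize (INR n) ((-1) ^ n); intros q r; auto_derive; [easy|ring]. }
  apply (is_derive_RInt_param (fun x s => (-1) ^ n * (INR n * cos (INR n * PI * s) * cos (INR n * x * s)))).
  - apply filter_forall; intros y s _; eexists; apply hd.
  - intros s _.
    apply (continuity_2d_pt_ext (fun y s =>
      ((-1) ^ n * (INR n * cos (INR n * PI * s) * - (sin (INR n * y * s) * (INR n * s)))))).
    { intros y t; symmetry; apply is_derive_unique, hd. }
    apply continuity_2d_pt_mult; [apply continuity_2d_pt_const|].
    apply continuity_2d_pt_mult.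
    + apply continuity_2d_pt_mult; [apply continuity_2d_pt_const|].
      apply continuity_1d_2d_pt_comp; [apply continuity_cos|].
      apply continuity_2d_pt_mult; [apply continuity_2d_pt_const|apply continuity_2d_pt_id2].
    + apply continuity_2d_pt_opp.
      apply continuity_2d_pt_mult.
      * apply continuity_1d_2d_pt_comp; [apply continuity_sin|].
        apply continuity_2d_pt_mult; [|apply continuity_2d_pt_id2].
        apply continuity_2d_pt_mult; [apply continuity_2d_pt_const|apply continuity_2d_pt_id1].
      * apply continuity_2d_pt_mult; [apply continuity_2d_pt_const|apply continuity_2d_pt_id2].
  - apply filter_forall; intros y; apply ex_RInt_kernel.
Qed.

(** Product-to-sum yields the frequencies n (x - PI) and n (x + PI). At s = 1 both sines equal
    (-1)^n sin nx, the sign cancels the prefactor, and 1 / (2 (x - PI)) + 1 / (2 (x + PI)) = x /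
    (x^2 - PI^2). *)
Lemma coskernel_eq (n : nat) (x : R) (hx : 0 <= x) (hp : x <> PI) :
  coskernel n x = sin (INR n * x) * (x / (x ^ 2 - PI ^ 2)).
Proof.
  pose proof PI_RGT_0 as hpi.
  assert (h2 : x ^ 2 - PI ^ 2 <> 0).
  { replace (x ^ 2 - PI ^ 2) with ((x - PI) * (x + PI)) by ring.
    apply Rmult_integral_contrapositive; split; lra. }
  assert (hsq : (-1) ^ n * (-1) ^ n = 1) by (rewrite <- Rpow_mult_distr; replace (-1 * -1) with 1 by ring; apply pow1).
  set (P := fun s => (-1) ^ n * (sin (INR n * (x - PI) * s) / (2 * (x - PI)) + sin (INR n * (x + PI) * s) / (2 * (x + PI)))).
  unfold coskernel; apply is_RInt_unique.
  replace (sin (INR n * x) * (x / (x ^ 2 - PI ^ 2))) with (P 1 - P 0).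
  2:{ unfold P. rewrite !Rmult_1_r, !Rmult_0_r, sin_0.
      replace (INR n * (x - PI)) with (INR n * x - INR n * PI) by ring.
      replace (INR n * (x + PI)) with (INR n * x + INR n * PI) by ring.
      rewrite sin_minus, sin_plus, sin_INR_PI, cos_INR_PI.
      replace (sin (INR n * x) * (x / (x ^ 2 - PI ^ 2)))
        with ((((-1) ^ n * (-1) ^ n)) * (sin (INR n * x) * (x / (x ^ 2 - PI ^ 2)))) by (rewrite hsq; ring).
      field; repeat split; lra. }
  apply is_RInt_of_is_derive; [lra| |].
  - intros s _; unfold P.
    apply is_derive_scal.
    replace (INR n * cos (INR n * PI * s) * cos (INR n * x * s))
      with (INR n * (cos (INR n * (x + PI) * s) + cos (INR n * (x - PI) * s)) / 2).
    + generalize (INR n); intros q; auto_derive; [easy|field; lra].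
    + rewrite form1.
      replace ((INR n * (x + PI) * s - INR n * (x - PI) * s) / 2) with (INR n * PI * s) by field.
      replace ((INR n * (x + PI) * s + INR n * (x - PI) * s) / 2) with (INR n * x * s) by field.
      field.
  - intros s _; continuous_by_derive; easy.
Qed.

Lemma is_RInt_term (n : nat) (B : R) (hB : 0 <= B) :
  is_RInt (fun x => 2 * expform n x * coskernel n x) 0 B (termprim n B - termprim n 0).
Proof.
  apply is_RInt_of_is_derive; [exact hB| |].
  - intros; apply is_derive_termprim.
  - intros x _. apply (continuous_mult (K := R_AbsRing)); [apply continuous_expform|apply continuous_coskernel].
Qed.

(** The modulus of e^{-n (al + it) x} / (al + it) is at most e^{-n al x} / al. The 2 pays for
    bounding the two parts separately, through al (al + |t|) <= 2 (al^2 + t^2). *)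
Lemma abs_resform_le (n : nat) (x t : R) :
  Rabs (resform n x t) <= exp (- (INR n * al * x)) * (2 * (Rabs c1 + Rabs c2) / al).
Proof.
  pose proof (sumsq_pos t) as h. 
  unfold resform; set (q := INR n * t * x).
  unfold Rdiv at 1; rewrite Rmult_assoc.
  rewrite Rabs_mult, (Rabs_pos_eq (exp _)) by apply Rlt_le, exp_pos.
  apply Rmult_le_compat_l; [apply Rlt_le, exp_pos|].
  rewrite Rabs_mult, (Rabs_pos_eq (/ _)) by (apply Rlt_le, Rinv_0_lt_compat; lra).
  apply Rle_div_l; [lra|].
  assert (hc : Rabs (cos q) <= 1) by apply Rabs_le, COS_bound.
  assert (hs : Rabs (sin q) <= 1) by apply Rabs_le, SIN_bound.
  pose proof (Rabs_pos c1); pose proof (Rabs_pos c2); pose proof (Rabs_pos t).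
  pose proof (Rabs_pos (cos q)); pose proof (Rabs_pos (sin q)).
  assert (h1 : Rabs (c1 * cos q + c2 * sin q) <= Rabs c1 + Rabs c2).
  { eapply Rle_trans; [apply Rabs_triang|]; rewrite !Rabs_mult; nra. }
  assert (h2 : Rabs (c2 * cos q - c1 * sin q) <= Rabs c1 + Rabs c2).
  { eapply Rle_trans; [apply Rabs_triang|]; rewrite Rabs_Ropp, !Rabs_mult; nra. }
  eapply Rle_trans; [apply Rabs_triang|].
  rewrite (Rabs_mult _ al), (Rabs_mult _ t), (Rabs_pos_eq al) by lra.
  apply Rle_trans with ((Rabs c1 + Rabs c2) * (al + Rabs t)); [nra|].
  replace (2 * (Rabs c1 + Rabs c2) / al * (al ^ 2 + t ^ 2))
    with ((Rabs c1 + Rabs c2) * (2 * (al ^ 2 + t ^ 2) / al)) by (field; lra).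
  apply Rmult_le_compat_l; [lra|].
  apply Rle_div_r; [lra|]. rewrite <- (pow2_abs t); nra.
Qed.

Lemma abs_termprim_le (n : nat) (B : R) :
  Rabs (termprim n B) <= exp (- (INR n * al * B)) * (4 * (Rabs c1 + Rabs c2) / al).
Proof.
  set (K := exp (- (INR n * al * B)) * (4 * (Rabs c1 + Rabs c2) / al)).
  replace K with ((1 - 0) * K) by ring.
  apply abs_RInt_le_const; [lra|apply ex_RInt_of_continuous, continuous_primform|].
  intros s _; unfold primform.
  pose proof (abs_resform_le n B (be + s)) as h1.
  pose proof (abs_resform_le n B (be - s)) as h2.
  assert (hK : K = 2 * (exp (- (INR n * al * B)) * (2 * (Rabs c1 + Rabs c2) / al))) by (unfold K; field; lra).
  assert (hc : Rabs (cos (INR n * PI * s)) <= 1) by apply Rabs_le, COS_bound.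
  rewrite Rabs_mult, Rabs_Ropp, !Rabs_mult, abs_pow_neg_1, (Rabs_pos_eq 2) by lra.
  pose proof (Rabs_triang (resform n B (be + s)) (resform n B (be - s))) as h3.
  unfold Rdiv; rewrite Rabs_mult, (Rabs_pos_eq (/ 2)) by lra.
  pose proof (Rabs_pos (resform n B (be + s) + resform n B (be - s))).
  pose proof (Rabs_pos (cos (INR n * PI * s))).
  set (y := Rabs (resform n B (be + s) + resform n B (be - s))) in *.
  assert (y <= K) by lra. nra.
Qed.

(** For n >= 1, e^{-n al B} <= 1 / (al B) because exp y >= 1 + y. Decay in B at fixed N is all that
    is wanted, so the same bound is added N + 1 times. *)
Lemma abs_sum_termprim_le (N : nat) (B : R) (hB : 0 < B) :
  Rabs (sum_f_R0 (fun k => termprim (S k) B) N) <= (INR N + 1) * (4 * (Rabs c1 + Rabs c2) / al ^ 2) / B.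
Proof.
  assert (h : forall k, Rabs (termprim (S k) B) <= 4 * (Rabs c1 + Rabs c2) / al ^ 2 / B).
  { intros k; eapply Rle_trans; [apply abs_termprim_le|].
    pose proof (pos_INR k) as hk; pose proof (Rabs_pos c1); pose proof (Rabs_pos c2).
    assert (hab : 0 < al * B) by nra.
    assert (he : exp (- (INR (S k) * al * B)) <= / (al * B)).
    { rewrite exp_Ropp; apply Rinv_le_contravar; [exact hab|].
      pose proof (exp_ineq1_le (INR (S k) * al * B)) as e. rewrite S_INR in *. nra. }
    replace (4 * (Rabs c1 + Rabs c2) / al ^ 2 / B) with (/ (al * B) * (4 * (Rabs c1 + Rabs c2) / al)) by (field; lra).
    apply Rmult_le_compat_r; [|exact he].
    apply Rmult_le_pos; [lra|apply Rlt_le, Rinv_0_lt_compat; lra]. }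
  induction N as [|N IH].
  - simpl sum_f_R0. eapply Rle_trans; [apply h|]. simpl; right; field; lra.
  - rewrite tech5. eapply Rle_trans; [apply Rabs_triang|].
    specialize (h (S N)). rewrite S_INR.
    replace ((INR N + 1 + 1) * (4 * (Rabs c1 + Rabs c2) / al ^ 2) / B)
      with ((INR N + 1) * (4 * (Rabs c1 + Rabs c2) / al ^ 2) / B + 4 * (Rabs c1 + Rabs c2) / al ^ 2 / B) by (field; lra).
    lra.
Qed.

Lemma continuous_phiform (s : R) : continuous phiform s.
Proof.
  pose proof (sumsq_pos (be + s)); pose proof (sumsq_pos (be - s)).
  unfold phiform; continuous_by_derive.
  repeat split; nra.
Qed.

(** At x = 0 the exponentials become 1 and the two [resform] terms average to [phiform]. The minus
    sign makes the lower end of the integral contribute positively. *)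
Lemma sum_termprim_0 (N : nat) :
  sum_f_R0 (fun k => termprim (S k) 0) N = - RInt (fun s => cosker N s * phiform s) 0 1.
Proof.
  assert (hc : forall n, termprim n 0 = - RInt (fun s => 2 * (-1) ^ n * cos (INR n * PI * s) * phiform s) 0 1).
  { intros n; unfold termprim. 
    rewrite <- (RInt_opp (V := R_CompleteNormedModule)).
    - apply (RInt_ext (V := R_CompleteNormedModule)); intros s _.
      unfold primform, resform, phiform, opp; simpl.
      rewrite !Rmult_0_r, Ropp_0, exp_0, cos_0, sin_0.
      pose proof (sumsq_pos (be + s)); pose proof (sumsq_pos (be - s)). field; split; nra.
    - apply ex_RInt_of_continuous; intros s; apply (continuous_mult (K := R_AbsRing)); [|apply continuous_phiform].
      continuous_by_derive; easy. }
  induction N as [|N IH]; [apply hc|].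
  rewrite tech5, IH, hc, <- Ropp_plus_distr; f_equal.
  symmetry; apply is_RInt_unique.
  apply (is_RInt_ext (fun s => cosker N s * phiform s +
     2 * (-1) ^ S (S N) * cos (INR (S (S N)) * PI * s) * phiform s)).
  { intros s _; unfold cosker at 2; rewrite tech5; fold (cosker N s).
    symmetry; apply Rmult_plus_distr_r. }
  apply (is_RInt_plus (V := R_NormedModule)); apply (RInt_correct (V := R_CompleteNormedModule));
    apply ex_RInt_of_continuous; intros s; apply (continuous_mult (K := R_AbsRing));
    try apply continuous_phiform; try apply continuous_cosker.
  continuous_by_derive; easy.
Qed.

Lemma is_RInt_sum_term (N : nat) (B : R) (hB : 0 <= B) :
  is_RInt (fun x => sum_f_R0 (fun k => 2 * expform (S k) x * coskernel (S k) x) N) 0 B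
    (sum_f_R0 (fun k => termprim (S k) B) N + RInt (fun s => cosker N s * phiform s) 0 1).
Proof.
  rewrite <- (Ropp_involutive (RInt _ 0 1)), <- sum_termprim_0.
  induction N as [|N IH]; [exact (is_RInt_term 1 B hB)|].
  rewrite !tech5.
  pose proof (is_RInt_plus (V := R_NormedModule) _ _ _ _ _ _ IH (is_RInt_term (S (S N)) B hB)) as h.
  evar_last; [exact h|]. unfold plus; simpl; ring.
Qed.
End Term.

(** * The complex exponential *)

Lemma Cmod_Cexp (z : C) : Cmod (Cexp z) = exp (Re z).
Proof.
  unfold Cexp, Cmod; simpl fst; simpl snd.
  replace ((exp (Re z) * cos (Im z)) ^ 2 + (exp (Re z) * sin (Im z)) ^ 2)
    with (exp (Re z) ^ 2 * (Rsqr (sin (Im z)) + Rsqr (cos (Im z)))) by (unfold Rsqr; ring).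
  rewrite sin2_cos2, Rmult_1_r; apply sqrt_pow2, Rlt_le, exp_pos.
Qed.

Lemma Cexp_plus (z w : C) : Cexp (z + w) = (Cexp z * Cexp w)%C.
Proof.
  destruct z, w; unfold Cexp, Cmult; simpl; rewrite exp_plus, cos_plus, sin_plus.
  apply injective_projections; simpl; ring.
Qed.

Lemma Cexp_0 : Cexp 0 = 1.
Proof. unfold Cexp; simpl; rewrite exp_0, cos_0, sin_0; apply injective_projections; simpl; ring. Qed.

Lemma Cexp_opp_mult (z : C) : (Cexp z * Cexp (- z))%C = 1.
Proof. rewrite <- Cexp_plus, <- Cexp_0; f_equal; ring. Qed.

Lemma Cmod_le_abs (z : C) : Cmod z <= Rabs (Re z) + Rabs (Im z).
Proof.
  replace z with (RtoC (Re z) + Ci * RtoC (Im z))%C at 1.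
  2:{ destruct z; apply injective_projections; simpl; ring. }
  eapply Rle_trans; [apply Cmod_triangle|].
  rewrite Cmod_mult, !Cmod_R.
  assert (hi : Cmod Ci = 1) by (transitivity (sqrt 1); [unfold Cmod; f_equal; simpl; ring|apply sqrt_1]).
  rewrite hi; lra.
Qed.

Lemma abs_Re_mult_le (c z : C) : Rabs (Re (c * z)) <= Cmod c * Cmod z.
Proof. rewrite <- Cmod_mult; apply re_le_Cmod. Qed.

(** * Closed form and bound of the series remainder *)

Section Remainder.
Variables (a c : C).
Hypothesis ha : 0 < Re a.

Let al := Re a.
Let be := Im a.

Definition denom (x : R) : C := (Ccosh (a * RtoC x) - RtoC (cos x))%C.

Lemma denom_eq (x : R) :
  denom x = (cosh (al * x) * cos (be * x) - cos x, sinh (al * x) * sin (be * x)).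
Proof.
  unfold denom, Ccosh, Cexp, al, be, cosh, sinh; destruct a as [p q].
  apply injective_projections; simpl.
  - replace (p * x - q * 0) with (p * x) by ring.
    replace (p * 0 + q * x) with (q * x) by ring.
    rewrite cos_neg; field.
  - replace (p * x - q * 0) with (p * x) by ring.
    replace (p * 0 + q * x) with (q * x) by ring.
    rewrite sin_neg; field.
Qed.

(* |cosh (A + i b) - cos x|^2 = (cosh A - cos (b - x)) (cosh A - cos (b + x)). *)
Lemma Cmod_denom_ge (x : R) : al ^ 2 * x ^ 2 / 2 <= Cmod (denom x).
Proof.
  pose proof (cosh_ge_quadratic (al * x)) as h.
  apply Rle_trans with (cosh (al * x) - 1); [lra|].
  assert (h0 : 0 <= cosh (al * x) - 1) by (pose proof (pow2_ge_0 (al * x)); lra).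
  rewrite <- (sqrt_pow2 (cosh (al * x) - 1)) by exact h0.
  rewrite denom_eq; unfold Cmod; simpl fst; simpl snd.
  apply sqrt_le_1_alt.
  assert (hs : sinh (al * x) ^ 2 = cosh (al * x) ^ 2 - 1).
  { unfold sinh, cosh; rewrite exp_Ropp; pose proof (exp_pos (al * x)); field; lra. }
  pose proof (COS_bound (be * x - x)) as b1; pose proof (COS_bound (be * x + x)) as b2.
  replace ((cosh (al * x) * cos (be * x) - cos x) ^ 2 + (sinh (al * x) * sin (be * x)) ^ 2)
    with ((cosh (al * x) - cos (be * x - x)) * (cosh (al * x) - cos (be * x + x))).
  - nra.
  - rewrite Rpow_mult_distr, hs, cos_minus, cos_plus.
    assert (e1 : sin (be * x) ^ 2 = 1 - cos (be * x) ^ 2)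
      by (pose proof (sin2_cos2 (be * x)) as e; unfold Rsqr in e; lra).
    assert (e2 : sin x ^ 2 = 1 - cos x ^ 2) by (pose proof (sin2_cos2 x) as e; unfold Rsqr in e; lra).
    replace ((cosh (al * x) - (cos (be * x) * cos x + sin (be * x) * sin x)) *
      (cosh (al * x) - (cos (be * x) * cos x - sin (be * x) * sin x)))
      with ((cosh (al * x) - cos (be * x) * cos x) ^ 2 - sin (be * x) ^ 2 * sin x ^ 2) by ring.
    rewrite e1, e2; ring.
Qed.

Lemma denom_neq_0 (x : R) (hx : x <> 0) : denom x <> 0.
Proof.
  intros e; pose proof (Cmod_denom_ge x) as h; rewrite e, Cmod_0 in h.
  assert (0 < al) by exact ha.
  assert (0 < al ^ 2) by nra.
  assert (0 < x ^ 2) by (apply pow2_gt_0; exact hx). nra.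
Qed.

Definition decay (x : R) : C := Cexp (- (a * RtoC x)).

Lemma decay_pow (n : nat) (x : R) :
  (decay x ^ n)%C = Cexp (- (RtoC (INR n) * a * RtoC x)).
Proof.
  induction n as [|n IH].
  - simpl. rewrite <- Cexp_0; f_equal; ring.
  - rewrite S_INR, Cpow_S, IH; unfold decay; rewrite <- Cexp_plus; f_equal.
    rewrite RtoC_plus; ring.
Qed.

Lemma expform_eq (n : nat) (x : R) :
  expform al be (Re c) (Im c) n x = Re (c * decay x ^ n).
Proof.
  rewrite decay_pow; unfold expform, Cexp, al, be; destruct a as [p q], c as [c1 c2]; simpl.
  replace (- ((INR n * p - 0 * q) * x - (INR n * q + 0 * p) * 0)) with (- (INR n * p * x)) by ring.
  replace (- ((INR n * p - 0 * q) * 0 + (INR n * q + 0 * p) * x)) with (- (INR n * q * x)) by ring.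
  rewrite cos_neg, sin_neg; ring.
Qed.

(* tail n x / denom x is the remainder of 2 sum_{k >= 1} e^{-kax} sin kx after n terms. *)
Definition tail (n : nat) (x : R) : C :=
  (decay x ^ n * (RtoC (sin (INR (S n) * x)) - decay x * RtoC (sin (INR n * x))))%C.

(** One telescoping step. With p = e^{ax} and q = [decay x], pq = 1 and twice [denom x] is p + q - 2
    cos x; the rest is the recurrence sin (n+2)x = 2 cos x sin (n+1)x - sin nx. *)
Lemma two_decay_sin (n : nat) (x : R) :
  (2 * decay x ^ S n * RtoC (sin (INR (S n) * x)) * denom x = tail n x - tail (S n) x)%C.
Proof.
  pose proof (Cexp_opp_mult (a * RtoC x)) as h; fold (decay x) in h.
  unfold tail, denom, Ccosh; fold (decay x).
  assert (hs : RtoC (sin (INR (S (S n)) * x))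
      = (2 * RtoC (sin (INR (S n) * x)) * RtoC (cos x) - RtoC (sin (INR n * x)))%C).
  { rewrite <- !RtoC_mult, <- RtoC_minus; f_equal.
    replace (INR (S (S n)) * x) with (INR (S n) * x + x) by (rewrite !S_INR; ring).
    replace (INR n * x) with (INR (S n) * x - x) by (rewrite !S_INR; ring).
    rewrite sin_plus, sin_minus; ring. }
  rewrite hs, !Cpow_S.
  generalize dependent (Cexp (a * RtoC x)); intros p hp.
  generalize dependent (decay x); intros q hp.
  assert (hq : (p * q * q ^ n = q ^ n)%C) by (rewrite hp; ring).
  transitivity ((p * q * q ^ n) * RtoC (sin (INR (S n) * x)) + q ^ n * q * RtoC (sin (INR (S n) * x)) * (q - 2 * RtoC (cos x)))%C.
  - field.
  - rewrite hq; ring.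
Qed.

Lemma sum_expform_sin (N : nat) (x : R) (hx : x <> 0) :
  sum_f_R0 (fun k => 2 * expform al be (Re c) (Im c) (S k) x * sin (INR (S k) * x)) N
  = Re (c * ((RtoC (sin x) - tail (S N) x) / denom x)).
Proof.
  pose proof (denom_neq_0 x hx) as hd.
  assert (hre : forall n, 2 * expform al be (Re c) (Im c) n x * sin (INR n * x)
      = Re (c * (2 * decay x ^ n * RtoC (sin (INR n * x))))).
  { intros n; rewrite expform_eq; generalize (decay x ^ n)%C (sin (INR n * x)); intros z r.
    destruct z, c; simpl; ring. }
  assert (hq : forall n, (2 * decay x ^ S n * RtoC (sin (INR (S n) * x)) = (tail n x - tail (S n) x) / denom x)%C).
  { intros n; rewrite <- two_decay_sin; field; exact hd. }
  induction N as [|N IH].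
  - unfold sum_f_R0; rewrite hre, hq; f_equal; f_equal; f_equal; f_equal.
    (* The telescoping starts from [tail 0 x], which is sin x. *)
    unfold tail; simpl. rewrite Rmult_0_l, sin_0, Rmult_1_l; ring.
  - rewrite tech5, IH, hre, hq.
    replace (Re (c * ((RtoC (sin x) - tail (S N) x) / denom x)) + Re (c * ((tail (S N) x - tail (S (S N)) x) / denom x)))
      with (Re (c * ((RtoC (sin x) - tail (S N) x) / denom x) + c * ((tail (S N) x - tail (S (S N)) x) / denom x))) by reflexivity.
    f_equal; field; exact hd.
Qed.

Lemma integrand_eq (x : R) (hx : 0 <= x) (hp : x <> PI) :
  Re (c * integrand a x) = Re (c * (RtoC (sin x) / denom x)) * (x / (x ^ 2 - PI ^ 2)).
Proof.
  pose proof PI_RGT_0.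
  assert (h2 : x ^ 2 - PI ^ 2 <> 0).
  { replace (x ^ 2 - PI ^ 2) with ((x - PI) * (x + PI)) by ring.
    apply Rmult_integral_contrapositive; split; lra. }
  unfold integrand; fold (denom x).
  rewrite <- !RtoC_pow, <- RtoC_minus, <- RtoC_div by exact h2.
  rewrite Cmult_assoc.
  generalize (c * (RtoC (sin x) / denom x))%C (x / (x ^ 2 - PI ^ 2)); intros z r.
  destruct z; simpl; ring.
Qed.

Lemma remainder_eq (N : nat) (x : R) (hx : 0 < x) (hp : x <> PI) :
  Re (c * integrand a x) - sum_f_R0 (fun k => 2 * expform al be (Re c) (Im c) (S k) x * coskernel (S k) x) N
  = Re (c * (tail (S N) x / denom x)) * (x / (x ^ 2 - PI ^ 2)).
Proof.
  rewrite integrand_eq by lra.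
  rewrite (sum_eq _ (fun k => 2 * expform al be (Re c) (Im c) (S k) x * sin (INR (S k) * x) * (x / (x ^ 2 - PI ^ 2)))).
  2:{ intros k _; rewrite coskernel_eq by lra; symmetry; apply Rmult_assoc. }
  rewrite <- scal_sum, sum_expform_sin by lra.
  rewrite (Rmult_comm (x / _) (Re _)), <- Rmult_minus_distr_r; f_equal.
  replace (Re (c * (RtoC (sin x) / denom x)) - Re (c * ((RtoC (sin x) - tail (S N) x) / denom x)))
    with (Re (c * (RtoC (sin x) / denom x) - c * ((RtoC (sin x) - tail (S N) x) / denom x))) by reflexivity.
  f_equal; field; apply denom_neq_0; lra.
Qed.

(** Bounds |cos x - e^{-ax}| by K x: 1 comes from cos x, al from the modulus of the exponential, and
    |be| from each of the two parts of its rotation. *)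
Let K := 1 + al + 2 * Rabs be.

Lemma Cmod_cos_sub_decay_le (x : R) (hx : 0 <= x) : Cmod (RtoC (cos x) - decay x) <= K * x.
Proof.
  assert (hal : 0 < al) by exact ha.
  eapply Rle_trans; [apply Cmod_le_abs|].
  replace (decay x) with ((exp (- (al * x)) * cos (be * x), - (exp (- (al * x)) * sin (be * x))) : C).
  2:{ unfold decay, Cexp, al, be; destruct a as [p q]; simpl.
      replace (- (p * x - q * 0)) with (- (p * x)) by ring.
      replace (- (p * 0 + q * x)) with (- (q * x)) by ring.
      rewrite cos_neg, sin_neg; apply injective_projections; simpl; ring. }
  simpl.
  assert (he : 1 - al * x <= exp (- (al * x)) <= 1).
  { split; [pose proof (exp_ineq1_le (- (al * x))); lra|].
    rewrite <- exp_0; destruct (Req_dec_T (al * x) 0) as [->|h]; [rewrite Ropp_0; lra|].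
    apply Rlt_le, exp_increasing; nra. }
  pose proof (exp_pos (- (al * x))) as hpos.
  pose proof (one_sub_cos_le x hx) as h1.
  pose proof (abs_sin_le (be * x)) as h2.
  pose proof (one_sub_cos_le (Rabs (be * x)) (Rabs_pos _)) as h3.
  assert (h4 : cos (Rabs (be * x)) = cos (be * x)).
  { unfold Rabs; destruct (Rcase_abs (be * x)); [apply cos_neg|reflexivity]. }
  rewrite h4 in h3. rewrite Rabs_mult, (Rabs_pos_eq x hx) in h2, h3.
  pose proof (COS_bound x); pose proof (COS_bound (be * x)).
  assert (e1 : Rabs (cos x + - (exp (- (al * x)) * cos (be * x))) <= x + al * x + Rabs be * x).
  { apply Rabs_le; split; nra. }
  assert (e2 : Rabs (0 + - - (exp (- (al * x)) * sin (be * x))) <= Rabs be * x).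
  { rewrite Rplus_0_l, Ropp_involutive, Rabs_mult, (Rabs_pos_eq (exp _)) by lra.
    pose proof (Rabs_pos (sin (be * x))); nra. }
  unfold K; lra.
Qed.

(** By the addition formula the bracket is sin nx (cos x - q) + cos nx sin x with q = [decay x].
    Both summands carry x |x^2 - PI^2|: the second factor cancels the pole at PI, and x, with the
    numerator of x / (x^2 - PI^2), makes up for the double zero of [denom] at 0. *)
Lemma Cmod_tail_le (n : nat) (x : R) (hx : 0 <= x) :
  Cmod (tail n x) <= exp (- (INR n * al * x)) * (x * Rabs (x ^ 2 - PI ^ 2) * (INR n * K * x + 1)).
Proof.
  assert (ht : tail n x = (decay x ^ n * (RtoC (sin (INR n * x)) * (RtoC (cos x) - decay x)
      + RtoC (cos (INR n * x)) * RtoC (sin x)))%C).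
  { unfold tail; replace (INR (S n) * x) with (INR n * x + x) by (rewrite S_INR; ring).
    rewrite sin_plus, RtoC_plus, !RtoC_mult; ring. }
  assert (hm : Cmod (decay x ^ n) = exp (- (INR n * al * x))).
  { rewrite decay_pow, Cmod_Cexp; f_equal; unfold al; destruct a; simpl; ring. }
  rewrite ht, Cmod_mult, hm.
  apply Rmult_le_compat_l; [apply Rlt_le, exp_pos|].
  eapply Rle_trans; [apply Cmod_triangle|].
  rewrite !Cmod_mult, !Cmod_R.
  pose proof (abs_sin_INR_le_pole n x hx) as h1.
  pose proof (abs_sin_INR_le_pole 1 x hx) as h2; simpl in h2; rewrite !Rmult_1_l in h2.
  fold (pow x 2) in h2.
  pose proof (Cmod_cos_sub_decay_le x hx) as h3.
  assert (h4 : Rabs (cos (INR n * x)) <= 1) by apply Rabs_le, COS_bound.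
  pose proof (Rabs_pos (sin (INR n * x))); pose proof (Rabs_pos (sin x)); pose proof (Rabs_pos (cos (INR n * x))).
  pose proof (Cmod_ge_0 (RtoC (cos x) - decay x)).
  change (x * (x * 1)) with (x ^ 2) in *. change (PI * (PI * 1)) with (PI ^ 2) in *.
  apply Rle_trans with (INR n * x * Rabs (x ^ 2 - PI ^ 2) * (K * x) + 1 * (x * Rabs (x ^ 2 - PI ^ 2))).
  - apply Rplus_le_compat; apply Rmult_le_compat; assumption.
  - right; ring.
Qed.

(** Depends on n and x only through n x, so its integral is O(1 / n). The factor 2 / al^2 comes from
    the lower bound for [denom]. *)
Definition remainder_bound (n : nat) (x : R) : R :=
  Cmod c * (2 / al ^ 2) * (exp (- (INR n * al * x)) * (INR n * K * x + 1)).

Lemma abs_remainder_le (N : nat) (x : R) (hx : 0 < x) (hp : x <> PI) :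
  Rabs (Re (c * integrand a x) - sum_f_R0 (fun k => 2 * expform al be (Re c) (Im c) (S k) x * coskernel (S k) x) N)
  <= remainder_bound (S N) x.
Proof.
  pose proof PI_RGT_0 as hpi. assert (hal : 0 < al) by exact ha.
  assert (h2 : x ^ 2 - PI ^ 2 <> 0).
  { replace (x ^ 2 - PI ^ 2) with ((x - PI) * (x + PI)) by ring.
    apply Rmult_integral_contrapositive; split; lra. }
  rewrite remainder_eq, Rabs_mult by assumption.
  pose proof (Rabs_pos_lt _ h2) as hP.
  pose proof (Cmod_tail_le (S N) x ltac:(lra)) as ht.
  pose proof (Cmod_denom_ge x) as hd.
  pose proof (abs_Re_mult_le c (tail (S N) x / denom x)) as hr.
  rewrite Cmod_div in hr by (apply denom_neq_0; lra).
  rewrite Rabs_div, (Rabs_pos_eq x) by lra.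
  set (P := Rabs (x ^ 2 - PI ^ 2)) in *.
  set (Z := exp (- (INR (S N) * al * x)) * (INR (S N) * K * x + 1)).
  assert (hZ : 0 <= Z).
  { apply Rmult_le_pos; [apply Rlt_le, exp_pos|].
    assert (0 <= K) by (unfold K; pose proof (Rabs_pos be); lra). pose proof (pos_INR (S N)).
    assert (0 <= INR (S N) * K) by nra. nra. }
  assert (hd0 : 0 < al ^ 2 * x ^ 2 / 2) by (assert (0 < al ^ 2) by nra; assert (0 < x ^ 2) by nra; nra).
  assert (hq : Cmod (tail (S N) x) / Cmod (denom x) <= Z * x * P / (al ^ 2 * x ^ 2 / 2)).
  { apply Rmult_le_compat; [apply Cmod_ge_0|apply Rlt_le, Rinv_0_lt_compat; lra| |apply Rinv_le_contravar; lra].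
    unfold Z; eapply Rle_trans; [exact ht|right; ring]. }
  apply Rle_trans with (Cmod c * (Z * x * P / (al ^ 2 * x ^ 2 / 2)) * (x / P)).
  - apply Rmult_le_compat_r; [apply Rmult_le_pos; [lra|apply Rlt_le, Rinv_0_lt_compat; exact hP]|].
    eapply Rle_trans; [exact hr|]. apply Rmult_le_compat_l; [apply Cmod_ge_0|exact hq].
  - right; unfold remainder_bound; fold Z; field; repeat split; lra.
Qed.

Lemma remainder_bound_ge_0 (n : nat) (x : R) (hx : 0 <= x) : 0 <= remainder_bound n x.
Proof.
  assert (hal : 0 < al) by exact ha.
  unfold remainder_bound. apply Rmult_le_pos; [apply Rmult_le_pos; [apply Cmod_ge_0|]|].
  - apply Rmult_le_pos; [lra|apply Rlt_le, Rinv_0_lt_compat; nra].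
  - apply Rmult_le_pos; [apply Rlt_le, exp_pos|].
    assert (0 <= K) by (unfold K; pose proof (Rabs_pos be); lra). pose proof (pos_INR n).
    assert (0 <= INR n * K) by nra. nra.
Qed.

Lemma continuous_remainder_bound (n : nat) (x : R) : continuous (remainder_bound n) x.
Proof.
  unfold remainder_bound; generalize (INR n); intros q.
  continuous_by_derive; easy.
Qed.

Lemma RInt_remainder_bound_le (N : nat) (B : R) (hB : 0 <= B) :
  RInt (remainder_bound (S N)) 0 B <= Cmod c * (2 / al ^ 2) * (K / al ^ 2 + / al) / (INR N + 1).
Proof.
  assert (hal : 0 < al) by exact ha.
  assert (hK : 0 <= K) by (unfold K; pose proof (Rabs_pos be); lra).
  set (q := INR (S N)).
  assert (hq : 0 < q) by (apply lt_0_INR; lia).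
  set (L := Cmod c * (2 / al ^ 2)).
  assert (hL : 0 <= L).
  { apply Rmult_le_pos; [apply Cmod_ge_0|apply Rmult_le_pos; [lra|apply Rlt_le, Rinv_0_lt_compat; nra]]. }
  (* An explicit primitive. Its value at B is nonpositive and gets dropped, which makes the bound
     uniform in B. *)
  set (W := fun x => - (L * (exp (- (q * al * x)) * (K * x / al + (K / al ^ 2 + / al) / q)))).
  assert (h : is_RInt (remainder_bound (S N)) 0 B (W B - W 0)).
  { apply is_RInt_of_is_derive; [exact hB| |intros; apply continuous_remainder_bound].
    intros x _; unfold W, remainder_bound; fold q; fold L. generalize L K; intros.
    auto_derive; [easy|field; lra]. }
  rewrite (is_RInt_unique _ _ _ _ h).
  assert (hW : W B <= 0).
  { unfold W; rewrite <- Ropp_0; apply Ropp_le_contravar, Rmult_le_pos; [exact hL|].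
    apply Rmult_le_pos; [apply Rlt_le, exp_pos|].
    pose proof (Rinv_0_lt_compat _ hal); pose proof (Rinv_0_lt_compat _ hq).
    apply Rplus_le_le_0_compat.
    - apply Rmult_le_pos; [nra|lra].
    - apply Rmult_le_pos; [|lra]. apply Rplus_le_le_0_compat; [|lra].
      apply Rmult_le_pos; [lra|apply Rlt_le, Rinv_0_lt_compat; nra]. }
  assert (hW0 : W 0 = - (L * (K / al ^ 2 + / al) / (INR N + 1))).
  { unfold W, q; rewrite Rmult_0_r, Ropp_0, exp_0, S_INR. field.
    unfold q in hq; rewrite S_INR in hq; split; lra. }
  rewrite hW0; fold L; lra.
Qed.

(** * Continuity of the integrand across its removable singularities *)

(** By sin x = 2 sin (x / 2) cos (x / 2), [sq (/ 2)] takes up the zero of sin x at 0 and [cq] the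
    one at PI. *)
Let sq (k : R) := diffquot (fun x => sin (k * x)) 0 k.
Let shq (k : R) := diffquot (fun x => sinh (k * x)) 0 k.
Let cq := diffquot (fun x => cos (x / 2)) PI (- / 2).

Lemma continuous_sq (k x : R) : continuous (sq k) x.
Proof.
  apply continuous_diffquot.
  - rewrite Rmult_0_r; apply sin_0.
  - auto_derive; [easy|]. rewrite Rmult_0_r, cos_0; ring.
  - intros y; continuous_by_derive; easy.
Qed.

Lemma continuous_shq (k x : R) : continuous (shq k) x.
Proof.
  apply continuous_diffquot.
  - rewrite Rmult_0_r; apply sinh_0.
  - unfold sinh; auto_derive; [easy|]. rewrite Rmult_0_r, Ropp_0, exp_0; field.
  - intros y; unfold sinh; continuous_by_derive; easy.
Qed.

Lemma continuous_cq (x : R) : continuous cq x.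
Proof.
  apply continuous_diffquot.
  - apply cos_PI2.
  - auto_derive; [easy|]. change (PI * / 2) with (PI / 2). rewrite sin_PI2; ring.
  - intros y; continuous_by_derive; easy.
Qed.

(* Real and imaginary part of (cosh a x - cos x) / x^2, with the removable singularity at 0 filled in. *)
Let e1 (x : R) := 2 * shq (al / 2) x ^ 2 * cos (be * x) - 2 * sq (be / 2) x ^ 2 + 2 * sq (/ 2) x ^ 2.
Let e2 (x : R) := shq al x * sq be x.

Lemma cos_double_half (y : R) : cos y = 1 - 2 * sin (y / 2) ^ 2.
Proof. replace y with (2 * (y / 2)) at 1 by field; rewrite cos_2a_sin; ring. Qed.

(** The formulas cosh y = 1 + 2 sinh^2 (y / 2) and cos y = 1 - 2 sin^2 (y / 2) cancel the constants
    and leave summands divisible by x^2. *)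
Lemma denom_eq_scaled (x : R) (hx : x <> 0) : denom x = (x ^ 2 * e1 x, x ^ 2 * e2 x).
Proof.
  rewrite denom_eq; unfold e1, e2, sq, shq; rewrite !diffquot_eq by exact hx.
  rewrite Rminus_0_r.
  assert (hc : cosh (al * x) = 1 + 2 * sinh (al / 2 * x) ^ 2).
  { unfold cosh, sinh; replace (al * x) with (al / 2 * x + al / 2 * x) by field.
    rewrite Ropp_plus_distr, !exp_plus, !exp_Ropp; pose proof (exp_pos (al / 2 * x)); field; lra. }
  apply injective_projections; simpl fst; simpl snd; [|field; exact hx].
  rewrite hc.
  replace (be / 2 * x) with (be * x / 2) by field.
  replace (/ 2 * x) with (x / 2) by field.
  pose proof (cos_double_half (be * x)) as h1; pose proof (cos_double_half x) as h2.
  replace ((1 + 2 * sinh (al / 2 * x) ^ 2) * cos (be * x) - cos x)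
    with (2 * sinh (al / 2 * x) ^ 2 * cos (be * x) + (cos (be * x) - cos x)) by ring.
  replace (cos (be * x) - cos x) with (2 * sin (x / 2) ^ 2 - 2 * sin (be * x / 2) ^ 2) by (rewrite h1, h2; ring).
  field; exact hx.
Qed.

(** Away from 0 this is [denom_neq_0]. At 0 the pair is (a^2 + 1) / 2, which vanishes only at a = i
    and a = -i, and Re a > 0 excludes both. *)
Lemma scaled_denom_pos (x : R) : 0 < e1 x ^ 2 + e2 x ^ 2.
Proof.
  assert (hal : 0 < al) by exact ha.
  cut (e1 x <> 0 \/ e2 x <> 0); [intros [h|h]; apply pow2_gt_0 in h; [pose proof (pow2_ge_0 (e2 x))|pose proof (pow2_ge_0 (e1 x))]; lra|].
  destruct (Req_dec_T x 0) as [->|hx].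
  - assert (v1 : e1 0 = al ^ 2 / 2 - be ^ 2 / 2 + / 2).
    { unfold e1, sq, shq, diffquot; destruct (Req_dec_T 0 0); [|easy]. rewrite Rmult_0_r, cos_0; field. }
    assert (v2 : e2 0 = al * be).
    { unfold e2, sq, shq, diffquot; destruct (Req_dec_T 0 0); [reflexivity|easy]. }
    destruct (Req_dec_T be 0) as [hb|hb].
    + left; rewrite v1, hb; nra.
    + right; rewrite v2; apply Rmult_integral_contrapositive; split; lra.
  - pose proof (denom_neq_0 x hx) as h.
    destruct (Req_dec_T (e1 x) 0) as [h1|h1]; [|left; exact h1].
    right; intros h2; apply h; rewrite (denom_eq_scaled x hx), h1, h2, Rmult_0_r; reflexivity.
Qed.

Lemma continuous_e1 (x : R) : continuous e1 x.
Proof.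
  assert (hsq : forall f, continuous f x -> continuous (fun y => 2 * f y ^ 2) x).
  { intros f hf. apply (continuous_comp f (fun z => 2 * z ^ 2)); [exact hf|].
    continuous_by_derive; easy. }
  apply (continuous_plus (V := R_NormedModule)); [|apply hsq, continuous_sq].
  apply (continuous_minus (V := R_NormedModule)); [|apply hsq, continuous_sq].
  apply (continuous_mult (K := R_AbsRing)); [apply hsq, continuous_shq|].
  continuous_by_derive; easy.
Qed.

Lemma continuous_e2 (x : R) : continuous e2 x.
Proof. apply (continuous_mult (K := R_AbsRing)); [apply continuous_shq|apply continuous_sq]. Qed.

(** The continuous extension of [Re (c * integrand a x)] to x >= 0; the factor with [e1] and [e2] is
    Re (c / (e1 + i e2)). *)
Let ext (x : R) :=
  2 * sq (/ 2) x * cq x * ((Re c * e1 x + Im c * e2 x) * / (e1 x * e1 x + e2 x * e2 x)) * / (x + PI).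

Lemma continuous_ext_integrand (x : R) (hx : 0 <= x) : continuous ext x.
Proof.
  pose proof PI_RGT_0.
  apply (continuous_mult (K := R_AbsRing)).
  - apply (continuous_mult (K := R_AbsRing)).
    + apply (continuous_mult (K := R_AbsRing)); [|apply continuous_cq].
      apply (continuous_mult (K := R_AbsRing)); [apply continuous_const|apply continuous_sq].
    + apply (continuous_mult (K := R_AbsRing)).
      * apply (continuous_plus (V := R_NormedModule)); apply (continuous_mult (K := R_AbsRing));
          try apply continuous_const; [apply continuous_e1|apply continuous_e2].
      * apply continuous_Rinv_comp.
        -- apply (continuous_plus (V := R_NormedModule)); apply (continuous_mult (K := R_AbsRing));
             try apply continuous_e1; apply continuous_e2.
        -- pose proof (scaled_denom_pos x); simpl in *; lra.
  - continuous_by_derive; lra.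
Qed.

Lemma ext_integrand_eq (x : R) (hx : 0 < x) (hp : x <> PI) : ext x = Re (c * integrand a x).
Proof.
  pose proof PI_RGT_0 as hpi. pose proof (scaled_denom_pos x) as hs.
  rewrite integrand_eq by lra.
  rewrite denom_eq_scaled by lra.
  unfold ext; unfold sq at 1, cq at 1; rewrite !diffquot_eq by lra.
  replace (sin x) with (2 * sin (/ 2 * x) * cos (x / 2)).
  2:{ replace x with (2 * (x / 2)) at 3 by field. rewrite sin_2a. replace (/ 2 * x) with (x / 2) by field; reflexivity. }
  destruct c as [c1 c2]; simpl Re; simpl Im.
  generalize dependent (e1 x); generalize dependent (e2 x); intros v2 v1 hs.
  unfold Cdiv, Cinv; simpl.
  assert (x ^ 2 - PI ^ 2 <> 0).
  { replace (x ^ 2 - PI ^ 2) with ((x - PI) * (x + PI)) by ring.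
    apply Rmult_integral_contrapositive; split; lra. }
  field. simpl in *. repeat split; try lra.
  all: try (replace (x * x * v1 * (x * x * v1) + x * x * v2 * (x * x * v2)) with ((x * x) ^ 2 * (v1 * (v1 * 1) + v2 * (v2 * 1))) by ring;
    apply Rmult_integral_contrapositive; split; [apply pow_nonzero; nra|lra]).
  all: try nra.
Qed.

Lemma ex_RInt_Re_integrand (B : R) (hB : 0 <= B) : ex_RInt (fun x => Re (c * integrand a x)) 0 B.
Proof.
  apply (ex_RInt_ext_except ext _ 0 B PI hB).
  - intros x hx hp; apply ext_integrand_eq; lra.
  - apply (ex_RInt_continuous (V := R_CompleteNormedModule)).
    rewrite Rmin_left, Rmax_right by lra; intros x hx; apply continuous_ext_integrand; lra.
Qed.

Lemma RInt_integrand_partial_sum_le (N : nat) (B : R) (hB : 0 < B) :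
  Rabs (RInt (fun x => Re (c * integrand a x)) 0 B
    - RInt (fun s => cosker N s * phiform al be (Re c) (Im c) s) 0 1)
  <= Cmod c * (2 / al ^ 2) * (K / al ^ 2 + / al) / (INR N + 1)
     + (INR N + 1) * (4 * (Rabs (Re c) + Rabs (Im c)) / al ^ 2) / B.
Proof.
  pose proof (abs_sum_termprim_le al be (Re c) (Im c) ha N B hB) as h1.
  pose proof (is_RInt_sum_term al be (Re c) (Im c) ha N B ltac:(lra)) as h2.
  pose proof (RInt_remainder_bound_le N B ltac:(lra)) as h3.
  pose proof (ex_RInt_Re_integrand B ltac:(lra)) as h4.
  set (G := sum_f_R0 (fun k => termprim al be (Re c) (Im c) (S k) B) N) in *.
  set (Q := RInt (fun s => cosker N s * phiform al be (Re c) (Im c) s) 0 1) in *.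
  set (F := fun x => Re (c * integrand a x)) in *.
  set (S := fun x => sum_f_R0 (fun k => 2 * expform al be (Re c) (Im c) (S k) x * coskernel (S k) x) N) in *.
  assert (h5 : is_RInt (fun x => F x - S x) 0 B (RInt F 0 B - (G + Q))).
  { apply (is_RInt_minus (V := R_NormedModule)); [exact (RInt_correct (V := R_CompleteNormedModule) _ _ _ h4)|exact h2]. }
  assert (h6 : Rabs (RInt F 0 B - (G + Q)) <= RInt (remainder_bound (Datatypes.S N)) 0 B).
  { rewrite <- (is_RInt_unique _ _ _ _ h5).
    (* PI is excepted because the remainder bound rests on [coskernel_eq]; 0 is only an end
       point. *)
    apply (abs_RInt_le_except _ _ 0 B PI); [lra|eexists; exact h5| | |].
    - apply ex_RInt_of_continuous, continuous_remainder_bound.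
    - intros x hx; apply remainder_bound_ge_0; lra.
    - intros x hx hp; apply abs_remainder_le; [lra|exact hp]. }
  replace (RInt F 0 B - Q) with ((RInt F 0 B - (G + Q)) + G) by (generalize (RInt F 0 B); simpl; intros; ring).
  eapply Rle_trans; [apply Rabs_triang|]. unfold al in *; lra.
Qed.
End Remainder.

(** * Evaluation of the limit: partial fractions and the principal logarithm *)

Lemma is_derive_phiform (al be c1 c2 : R) (hal : 0 < al) (s : R) :
  is_derive (phiform al be c1 c2) s
    ((c2 * (al ^ 2 + (be + s) ^ 2) - (c1 * al + c2 * (be + s)) * (2 * (be + s))) / (al ^ 2 + (be + s) ^ 2) ^ 2 / 2
     - (c2 * (al ^ 2 + (be - s) ^ 2) - (c1 * al + c2 * (be - s)) * (2 * (be - s))) / (al ^ 2 + (be - s) ^ 2) ^ 2 / 2).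
Proof.
  pose proof (sumsq_pos al hal (be + s)); pose proof (sumsq_pos al hal (be - s)).
  unfold phiform; auto_derive.
  - repeat split; nra.
  - field; split; nra.
Qed.

Lemma RInt_phiform (al be c1 c2 : R) (hal : 0 < al) :
  RInt (phiform al be c1 c2) 0 1 =
  (c1 * (atan ((be + 1) / al) - atan ((be - 1) / al))
   + c2 / 2 * (ln (al ^ 2 + (be + 1) ^ 2) - ln (al ^ 2 + (be - 1) ^ 2))) / 2.
Proof.
  (* Both differences vanish at s = 0, so only the value at 1 survives. *)
  set (P := fun s => (c1 * (atan ((be + s) / al) - atan ((be - s) / al))
   + c2 / 2 * (ln (al ^ 2 + (be + s) ^ 2) - ln (al ^ 2 + (be - s) ^ 2))) / 2).
  apply is_RInt_unique; evar_last.
  - apply (is_RInt_of_is_derive P); [lra| |intros; apply continuous_phiform; exact hal].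
    intros s _; pose proof (sumsq_pos al hal (be + s)); pose proof (sumsq_pos al hal (be - s)).
    unfold P, phiform; auto_derive.
    + repeat split; nra.
    + field; unfold Rsqr; repeat split; try nra.
  - unfold P; rewrite Rplus_0_r, Rminus_0_r; field.
Qed.

Definition polar (r t : R) : C := (r * cos t, r * sin t).

Lemma Cmod_polar (r t : R) (hr : 0 <= r) : Cmod (polar r t) = r.
Proof.
  unfold Cmod, polar; simpl fst; simpl snd.
  replace ((r * cos t) ^ 2 + (r * sin t) ^ 2) with (r ^ 2 * (Rsqr (sin t) + Rsqr (cos t))) by (unfold Rsqr; ring).
  rewrite sin2_cos2, Rmult_1_r; apply sqrt_pow2; exact hr.
Qed.

Lemma Clog_polar (r t : R) (hr : 0 < r) (ht : - PI < t <= PI) : Clog (polar r t) = (ln r, t).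
Proof.
  unfold Clog, Carg; rewrite Cmod_polar by lra.
  f_equal; simpl.
  replace (r * cos t / r) with (cos t) by (field; lra).
  destruct (Rle_dec 0 (r * sin t)) as [h|h].
  - apply acos_cos; split; [|lra].
    destruct (Rle_dec 0 t) as [h0|h0]; [exact h0|exfalso].
    assert (0 < sin (- t)) by (apply sin_gt_0; lra). rewrite sin_neg in *; nra.
  - destruct (Rle_dec 0 t) as [h0|h0].
    + exfalso; apply h, Rmult_le_pos; [lra|apply sin_ge_0; lra].
    + rewrite <- cos_neg, acos_cos by lra; lra.
Qed.

Lemma polar_mult (r1 t1 r2 t2 : R) : (polar r1 t1 * polar r2 t2)%C = polar (r1 * r2) (t1 + t2).
Proof.
  unfold polar; apply injective_projections; simpl; rewrite ?cos_plus, ?sin_plus; ring.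
Qed.

Lemma polar_atan (p q : R) (hp : 0 < p) : ((p, q) : C) = polar (sqrt (p ^ 2 + q ^ 2)) (atan (q / p)).
Proof.
  assert (hs : sqrt (p ^ 2 + q ^ 2) = p * sqrt (1 + Rsqr (q / p))).
  { rewrite <- (sqrt_pow2 p) at 2 by lra. rewrite <- sqrt_mult_alt by apply pow2_ge_0.
    f_equal; unfold Rsqr; field; lra. }
  assert (h : 0 < sqrt (1 + Rsqr (q / p))) by (apply sqrt_lt_R0; pose proof (Rle_0_sqr (q / p)); lra).
  unfold polar; rewrite hs, cos_atan, sin_atan; f_equal; field; lra.
Qed.

Lemma ln_sqrt (x : R) (hx : 0 < x) : ln (sqrt x) = ln x / 2.
Proof.
  pose proof (sqrt_lt_R0 x hx) as h.
  rewrite <- (sqrt_sqrt x) at 2 by lra. rewrite ln_mult by exact h; field.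
Qed.

(** Both points lie in the right half-plane, so their arguments differ by less than PI and the
    principal logarithm of the quotient needs no multiple of 2 PI i. *)
Lemma Clog_ratio (p q q' : R) (hp : 0 < p) :
  Clog ((p, q') / (p, q))%C
  = ((ln (p ^ 2 + q' ^ 2) - ln (p ^ 2 + q ^ 2)) / 2, atan (q' / p) - atan (q / p)).
Proof.
  assert (h0 : 0 < p ^ 2 + q ^ 2) by nra. assert (h1 : 0 < p ^ 2 + q' ^ 2) by nra.
  pose proof (sqrt_lt_R0 _ h0) as s0. pose proof (sqrt_lt_R0 _ h1) as s1.
  assert (e : ((p, q') / (p, q))%C = polar (sqrt (p ^ 2 + q' ^ 2) / sqrt (p ^ 2 + q ^ 2)) (atan (q' / p) - atan (q / p))).
  { assert (hz : ((p, q) : C) <> 0) by (intros hz; injection hz; lra).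
    transitivity (polar (sqrt (p ^ 2 + q' ^ 2) / sqrt (p ^ 2 + q ^ 2)) (atan (q' / p) - atan (q / p)) * (p, q) / (p, q))%C.
    - f_equal. rewrite (polar_atan p q hp) at 1; rewrite (polar_atan p q' hp) at 1.
      rewrite polar_mult; f_equal; field; lra.
    - field; exact hz. }
  pose proof (atan_bound (q' / p)); pose proof (atan_bound (q / p)).
  rewrite e, Clog_polar; [|apply Rdiv_lt_0_compat; assumption|lra].
  f_equal. rewrite ln_div, !ln_sqrt by assumption; field.
Qed.

(** 1 + i / a = (a + i) / a and 1 - i / a = (a - i) / a, with all three points in the right
    half-plane; the logarithm of a cancels in the difference. *)
Lemma Catan_inv (a : C) (ha : 0 < Re a) :
  Catan (1 / a) = ((atan ((Im a + 1) / Re a) - atan ((Im a - 1) / Re a)) / 2,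
    - (ln (Re a ^ 2 + (Im a + 1) ^ 2) - ln (Re a ^ 2 + (Im a - 1) ^ 2)) / 4).
Proof.
  destruct a as [p q]; simpl Re in *; simpl Im.
  assert (hz : ((p, q) : C) <> 0) by (intros hz; injection hz; simpl in ha; lra).
  assert (e1 : (1 + Ci * (1 / (p, q)) = (p, q + 1)%R / (p, q))%C).
  { replace ((p, q + 1) : C) with ((p, q) + Ci)%C by (apply injective_projections; simpl; ring). field; exact hz. }
  assert (e2 : (1 - Ci * (1 / (p, q)) = (p, q - 1)%R / (p, q))%C).
  { replace ((p, q - 1) : C) with ((p, q) - Ci)%C by (apply injective_projections; simpl; ring). field; exact hz. }
  unfold Catan; rewrite e1, e2, !Clog_ratio by exact ha.
  generalize (ln (p ^ 2 + (q + 1) ^ 2)) (ln (p ^ 2 + (q - 1) ^ 2)) (ln (p ^ 2 + q ^ 2)); intros l1 l2 l0.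
  apply injective_projections; simpl; field.
Qed.

Lemma RInt_phiform_eq (a c : C) (ha : 0 < Re a) :
  RInt (phiform (Re a) (Im a) (Re c) (Im c)) 0 1 = Re (c * Catan (1 / a)).
Proof. rewrite RInt_phiform, Catan_inv by exact ha; destruct c; simpl; field. Qed.

(** Partial fractions: a / (1 + a^2) = (1 / (a + i) + 1 / (a - i)) / 2. *)
Lemma phiform_1_eq (a c : C) (ha : 0 < Re a) :
  phiform (Re a) (Im a) (Re c) (Im c) 1 = Re (c * (a / (1 + a ^ 2))).
Proof.
  destruct a as [p q], c as [c1 c2]; simpl in ha.
  change (phiform p q c1 c2 1 = Re ((c1, c2) * ((p, q) / (1 + (p, q) ^ 2)))).
  pose proof (sumsq_pos p ha (q + 1)); pose proof (sumsq_pos p ha (q - 1)).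
  assert (h1 : ((p, q + 1) : C) <> 0) by (intros hz; injection hz; simpl in ha; lra).
  assert (h2 : ((p, q - 1) : C) <> 0) by (intros hz; injection hz; simpl in ha; lra).
  assert (e1 : ((p, q + 1) : C) = ((p, q) + Ci)%C) by (apply injective_projections; simpl; ring).
  assert (e2 : ((p, q - 1) : C) = ((p, q) - Ci)%C) by (apply injective_projections; simpl; ring).
  assert (hi : (Ci * Ci = -1)%C) by (apply injective_projections; simpl; ring).
  assert (hf : (1 + (p, q) ^ 2 = ((p, q) + Ci) * ((p, q) - Ci))%C).
  { transitivity ((p, q) ^ 2 - Ci * Ci)%C; [rewrite hi; ring|ring]. }
  assert (e : ((p, q) / (1 + (p, q) ^ 2) = (/ (p, q + 1)%R + / (p, q - 1)%R) / 2)%C).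
  { rewrite hf, e1, e2; rewrite e1 in h1; rewrite e2 in h2; field; split; assumption. }
  rewrite e; unfold phiform, Cinv; simpl; field; simpl in *; split; nra.
Qed.

(** * Passage to the limit *)

Lemma Re_RInt_integrand_close (a c : C) (ha : 0 < Re a) (e : R) (he : 0 < e) :
  exists B0, forall B, B0 < B ->
    Rabs (RInt (fun x => Re (c * integrand a x)) 0 B - Re (c * (a / (1 + a ^ 2) - Catan (1 / a)))) < e.
Proof.
  assert (hL : Re (c * (a / (1 + a ^ 2) - Catan (1 / a)))
    = phiform (Re a) (Im a) (Re c) (Im c) 1 - RInt (phiform (Re a) (Im a) (Re c) (Im c)) 0 1).
  { rewrite RInt_phiform_eq, phiform_1_eq by exact ha.
    generalize (a / (1 + a ^ 2))%C (Catan (1 / a)); intros [] []; destruct c; simpl; ring. }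
  rewrite hL; set (L := phiform _ _ _ _ 1 - _).
  pose proof (is_lim_seq_cosine_sum (phiform (Re a) (Im a) (Re c) (Im c)) _
    (is_derive_phiform (Re a) (Im a) (Re c) (Im c) ha)) as hlim.
  specialize (hlim ltac:(
    intros s; pose proof (sumsq_pos _ ha (Im a + s)); pose proof (sumsq_pos _ ha (Im a - s));
    continuous_by_derive; repeat split; simpl in *; nra)).
  fold L in hlim; apply is_lim_seq_spec in hlim.
  destruct (hlim (mkposreal (e / 3) ltac:(lra))) as [N1 hN1]; simpl in hN1.
  set (C1 := Cmod c * (2 / Re a ^ 2) * ((1 + Re a + 2 * Rabs (Im a)) / Re a ^ 2 + / Re a)).
  destruct (INR_archimed (e / 3) C1) as [N2 hN2]; [lra|].
  (* [N1] controls the cosine series and [N2] the series remainder, each to e / 3. The last third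
     goes to the primitives at B, for which the threshold is chosen after N. *)
  set (N := max N1 N2).
  specialize (hN1 N ltac:(lia)).
  assert (hC1 : C1 / (INR N + 1) < e / 3).
  { pose proof (pos_INR N). apply Rlt_div_l; [lra|].
    assert (INR N2 <= INR N) by (apply le_INR; lia). nra. }
  set (C2 := (INR N + 1) * (4 * (Rabs (Re c) + Rabs (Im c)) / Re a ^ 2)).
  exists (Rmax 0 (C2 / (e / 3))); intros B hB.
  pose proof (Rmax_l 0 (C2 / (e / 3))); pose proof (Rmax_r 0 (C2 / (e / 3))).
  assert (hC2 : C2 / B < e / 3).
  { apply Rlt_div_l; [lra|]. rewrite Rmult_comm. apply Rlt_div_l; lra. }
  pose proof (RInt_integrand_partial_sum_le a c ha N B ltac:(lra)) as h.
  fold C1 in h; fold C2 in h.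
  set (I := RInt (fun x => Re (c * integrand a x)) 0 B) in *.
  set (Q := RInt (fun s => cosker N s * _) 0 1) in *.
  replace (I - L) with ((I - Q) + (Q - L)) by (generalize I Q; simpl; intros; ring).
  eapply Rle_lt_trans; [apply Rabs_triang|]; lra.
Qed.

Theorem mainTheorem11 (a : C) (ha : 0 < Re a) :
  is_RInt_gen (V := C_R_NormedModule) (integrand a)
    (at_point 0) (Rbar_locally p_infty)
    (a / (1 + a ^ 2) - Catan (1 / a))%C.
Proof.
  intros P [eps hP].
  destruct (Re_RInt_integrand_close a 1 ha eps (cond_pos eps)) as [B1 h1].
  destruct (Re_RInt_integrand_close a (- Ci) ha eps (cond_pos eps)) as [B2 h2].
  set (Bm := Rmax 0 (Rmax B1 B2)).
  apply (Filter_prod _ _ _ (fun x => x = 0) (fun B => Bm < B)).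
  - reflexivity.
  - exists Bm; intros; assumption.
  - intros x B -> hB; simpl.
    pose proof (Rmax_l 0 (Rmax B1 B2)); pose proof (Rmax_r 0 (Rmax B1 B2)).
    pose proof (Rmax_l B1 B2); pose proof (Rmax_r B1 B2). unfold Bm in hB.
    specialize (h1 B ltac:(lra)); specialize (h2 B ltac:(lra)).
    assert (r1 : forall z : C, Re (1 * z) = Re z) by (intros []; simpl; ring).
    assert (r2 : forall z : C, Re (- Ci * z) = Im z) by (intros []; simpl; ring).
    rewrite r1 in h1; rewrite r2 in h2.
    exists (RInt (fun x => Re (1 * integrand a x)) 0 B, RInt (fun x => Re (- Ci * integrand a x)) 0 B).
    split.
    + apply (is_RInt_fct_extend_pair (U := R_NormedModule) (V := R_NormedModule)).
      * apply (is_RInt_ext (fun x => Re (1 * integrand a x))); [intros; apply r1|].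
        apply (RInt_correct (V := R_CompleteNormedModule)), ex_RInt_Re_integrand; [exact ha|lra].
      * apply (is_RInt_ext (fun x => Re (- Ci * integrand a x))); [intros; apply r2|].
        apply (RInt_correct (V := R_CompleteNormedModule)), ex_RInt_Re_integrand; [exact ha|lra].
    (* Balls of the product structure are taken componentwise, so closeness within [eps] of each
       part is enough. *)
    + apply hP; split; assumption.
Qed.
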